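(* Let $\Upsilon$ be the tree in which every node at level $n$ has exactly $n+1$ immediate successors ($n\in\omega$), and let $\mathcal A_\Upsilon$ be the almost disjoint family of its branches. Let $\mathcal A_2$ be the almost disjoint family of branches of the dyadic tree $2^{<\omega}$. Then for every $p\in(1,\infty]$, the Banach space $\mathrm{JL}_p(\mathcal A_\Upsilon)$ is not isomorphic to a subspace of $\mathrm{JL}_p(\mathcal A_2)$.
   Context: An almost disjoint (AD) family on a countable set $N$ is a family $\mathcal A$ of infinite subsets of $N$ such that $A\cap B$ is finite for any distinct $A,B\in\mathcal A$. The space $\psi(\mathcal A)=N\cup\mathcal A$ is topologized so that points of $N$ are isolated and the sets $\{A\}\cup(A\setminus F)$, $F\subseteq N$ finite, form a local base at $A\in\mathcal A$; $K_{\mathcal A}=\psi(\mathcal A)\cup\{\infty\}$ is the one-point compactification of this locally compact space. $C(K_{\mathcal A})$ is the Banach space of real-valued continuous functions on $K_{\mathcal A}$ with the supremum norm $\|\cdot\|_\infty$. For $1<p<\infty$ and $f\in C(K_{\mathcal A})$ put $\|f\|_p'=\big(\sum_{A\in\mathcal A}|f(A)|^p\big)^{1/p}$ and $\|f\|_p=\max\{\|f\|_\infty,\|f\|_p'\}$; then $\mathrm{JL}_p(\mathcal A)=\{f\in C(K_{\mathcal A}):\|f\|_p'<\infty\}$ with norm $\|\cdot\|_p$. For $p=\infty$, $\mathrm{JL}_\infty(\mathcal A)=C(K_{\mathcal A})$ with the supremum norm. Trees are subtrees (downwards closed subsets, containing the empty sequence) of the tree $\omega^{<\omega}$ of finite sequences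 of natural numbers ordered by end-extension; the level of a node is its length. For a tree $T$, $[T]$ is the set of $x\in\omega^\omega$ all of whose finite initial segments $x|n$ belong to $T$, and $\mathcal A_T=\{B(x):x\in[T]\}$, with $B(x)=\{x|n:n\in\omega\}$, is an AD family on $T$; $\mathcal A_2=\mathcal A_{2^{<\omega}}$. ''Isomorphic'' means linearly homeomorphic. *)

(* Defs.v *)
From HB Require Import structures.
From mathcomp Require Import all_boot all_order all_algebra.
From mathcomp Require Import all_classical all_reals all_analysis.
From mathcomp Require Import ring.

Set Implicit Arguments.
Unset Strict Implicit.
Unset Printing Implicit Defensive.

Import Order.TTheory GRing.Theory Num.Theory.
Import numFieldNormedType.Exports.

Local Open Scope classical_set_scope.
Local Open Scope ring_scope.

Variant psi (N : countType) (AA : set (set N)) : Type :=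
| psi_point of N
| psi_set of AA.

Arguments psi_point {N AA}.
Arguments psi_set {N AA}.

Section psi_topology.
Context (N : countType) (AA : set (set N)).

HB.instance Definition _ := gen_eqMixin (psi AA).
HB.instance Definition _ := gen_choiceMixin (psi AA).

Definition psi_base (A : AA) (F : set N) : set (psi AA) :=
  psi_set A |` (psi_point @` (val A `\` F)).

Definition psi_nbhs (x : psi AA) : set_system (psi AA) :=
  match x with
  | psi_point n => principal_filter (psi_point n)
  | psi_set A => filter_from [set F : set N | finite_set F] (psi_base A)
  end.

Let psi_nbhs_filter (x : psi AA) : ProperFilter (psi_nbhs x).
Proof.
case: x => [n|A] /=; first exact: principal_filter_proper.
apply: filter_from_proper; last by move=> F _; exists (psi_set A); left.
apply: filter_from_filter; first by exists set0; exact: finite_set0.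
move=> F G finF finG; exists (F `|` G); first by rewrite /= finite_setU.
move=> x [->|[n [An /not_orP[nF nG]] <-]]; first by split; left.
by split; right; exists n.
Qed.

Let psi_nbhs_singleton (x : psi AA) U : psi_nbhs x U -> U x.
Proof.
case: x => [n|A] /=; first by move/principal_filterP.
by move=> [F _]; apply; left.
Qed.

Let psi_nbhs_nbhs (x : psi AA) U :
  psi_nbhs x U -> psi_nbhs x (psi_nbhs^~ U).
Proof.
case: x => [n|A] /=; first by move=> Un; apply/principal_filterP.
move=> [F finF FU]; exists F => // x [->|[n AFn <-]]; first by exists F.
by apply/principal_filterP; apply: FU; right; exists n.
Qed.

HB.instance Definition _ := hasNbhs.Build (psi AA) psi_nbhs.
HB.instance Definition _ := @Nbhs_isNbhsTopological.Build (psi AA)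
  psi_nbhs_filter psi_nbhs_singleton psi_nbhs_nbhs.

End psi_topology.

Notation KA AA := (one_point_compactification (psi AA)).

Section JL_norm.
Context (R : realType) (N : countType) (AA : set (set N)).
Implicit Types (f g : KA AA -> R^o) (r : R) (p : \bar R).

Definition supnorm f : R := sup (range (fun x => `|f x|)).

Definition lp_sum r f : \bar R :=
  (\esum_(A in [set: AA]) (`|f (Some (psi_set A))| `^ r)%:E)%E.

(* Extended-real valued: [+oo] when the [r]-th powers are not summable. *)
Definition lp_seminorm r f : \bar R := (lp_sum r f `^ r^-1)%E.

(* The value at [-oo] is irrelevant: only [1 < p] is used. *)
Definition JL_norm p f : R :=
  if p is r%:E then Num.max (supnorm f) (fine (lp_seminorm r f))
  else supnorm f.

Definition JL_set p : set (KA AA -> R^o) :=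
  [set f | continuous f /\ if p is r%:E then (lp_seminorm r f < +oo)%E else True].

Definition JL_pred p : {pred KA AA -> R^o} := mem (JL_set p).

Lemma supnorm_has_sup f : continuous f -> has_sup (range (fun x => `|f x|)).
Proof.
move=> cf; split; first by exists `|f None|; exists None.
have /compact_bounded[M [_ MB]] : compact (range f).
  apply: continuous_compact; first exact: continuous_subspaceT.
  exact: one_point_compactification_compact.
exists (M + 1) => _ [x _ <-]; apply: (MB (M + 1)); first by rewrite ltrDl.
by exists x.
Qed.

Lemma supnorm_ub f x : continuous f -> `|f x| <= supnorm f.
Proof.
by move=> /supnorm_has_sup[_ uf]; apply: ub_le_sup => //; exists x.
Qed.

Lemma supnorm_le f (M : R) : (forall x, `|f x| <= M) -> supnorm f <= M.
Proof.
by move=> fM; apply: ge_sup; [exists `|f None|; exists None|move=> _ [x _ <-]].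
Qed.

Lemma supnorm_ge0 f : continuous f -> 0 <= supnorm f.
Proof. by move=> cf; apply: le_trans (supnorm_ub None cf). Qed.

Lemma lp_sum_ge0 r f : (0 <= lp_sum r f)%E.
Proof. by apply: esum_ge0 => A _; rewrite lee_fin powR_ge0. Qed.

Lemma lp_seminorm_ge0 r f : (0 <= lp_seminorm r f)%E.
Proof. exact: poweR_ge0. Qed.

Lemma lp_seminorm_le r f (a : R) : 0 < r -> 0 <= a ->
  (lp_seminorm r f <= a%:E)%E = (lp_sum r f <= (a `^ r)%:E)%E.
Proof.
move=> r0 a0; have rN0 : r != 0 by rewrite gt_eqF.
apply/idP/idP => h.
- have := @gt0_ler_poweR _ r (ltW r0) _ _ _ _ h.
  rewrite !in_itv/= ?andbT !leey !lp_seminorm_ge0 lee_fin a0 => /(_ isT isT).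
  by rewrite -poweRrM mulVf// poweRe1 ?lp_sum_ge0.
- have rV0 : 0 <= r^-1 by rewrite invr_ge0 ltW.
  have := gt0_ler_poweR rV0 _ _ h.
  rewrite !in_itv/= !leey !lp_sum_ge0 lee_fin powR_ge0 => /(_ isT isT).
  by rewrite -powRrM mulfV// powRr1.
Qed.

Lemma esumZ_le (I : choiceType) (a : I -> \bar R) (c : R) : 0 <= c ->
  (forall i, 0 <= a i)%E ->
  (\esum_(i in [set: I]) (c%:E * a i) <= c%:E * \esum_(i in [set: I]) a i)%E.
Proof.
move=> c0 a0; apply: ub_ereal_sup => _ [F [finF _] <-].
rewrite -ge0_mule_fsumr//; apply: lee_wpmul2l; first by rewrite lee_fin.
by apply: ereal_sup_ubound; exists F.
Qed.

Lemma lp_seminormZ r (l : R) f (a : R) : 0 < r -> 0 <= a ->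
  (lp_seminorm r f <= a%:E)%E -> (lp_seminorm r (l *: f) <= (`|l| * a)%:E)%E.
Proof.
move=> r0 a0; rewrite !lp_seminorm_le ?mulr_ge0// powRM// => fa.
rewrite EFinM; apply: (@le_trans _ _ ((`|l| `^ r)%:E * lp_sum r f)%E).
  apply: le_trans (esumZ_le _ _); last 2 first.
  - exact: powR_ge0.
  - by move=> A; rewrite lee_fin powR_ge0.
  by apply: le_esum => A _; rewrite -EFinM -powRM// -normrM lee_fin.
by apply: lee_wpmul2l => //; rewrite lee_fin powR_ge0.
Qed.

Lemma lp_convex r (a b u v : R) : 1 <= r -> 0 < a -> 0 < b -> 0 <= u -> 0 <= v ->
  (u + v) `^ r <= (a + b) `^ r * (a / (a + b)) / (a `^ r) * u `^ r +
                  (a + b) `^ r * (b / (a + b)) / (b `^ r) * v `^ r.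
Proof.
move=> r1 a0 b0 u0 v0.
have ab0 : 0 < a + b by rewrite addr_gt0.
have t0 : 0 <= a / (a + b) by rewrite divr_ge0 ?ltW.
have t1 : a / (a + b) <= 1 by rewrite ler_pdivrMr// mul1r lerDl ltW.
have := convex_powR r1 (Itv01 t0 t1) (x := u / a) (y := v / b).
rewrite !inE/= !in_itv/= !divr_ge0 ?(ltW a0) ?(ltW b0)// => /(_ isT isT).
rewrite convRE [X in X `^ _ <= _ -> _]convRE/= => h.
have tb : 1 - a / (a + b) = b / (a + b).
  by rewrite -[X in X - _](@divff _ (a + b)) ?gt_eqF// -mulrBl addrC addKr.
rewrite /unstable.onem tb in h.
have -> : u + v = (a + b) * (a / (a + b) * (u / a) + b / (a + b) * (v / b)).
  by field; rewrite !gt_eqF.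
rewrite powRM ?(ltW ab0)//; last first.
  by rewrite addr_ge0// mulr_ge0// divr_ge0// ltW.
apply: (le_trans (ler_wpM2l (powR_ge0 _ _) h)).
have powRV c : 0 < c -> c^-1 `^ r = (c `^ r)^-1.
  by move=> c0; rewrite -(powR_inv1 (ltW c0)) -powRrM mulN1r powRN.
rewrite mulrDr !powRM ?invr_ge0 ?(ltW a0) ?(ltW b0)// !powRV//.
by rewrite le_eqVlt; apply/orP; left; apply/eqP; ring.
Qed.

Lemma lp_seminormD r f g (a b : R) : 1 <= r -> 0 < a -> 0 < b ->
  (lp_seminorm r f <= a%:E)%E -> (lp_seminorm r g <= b%:E)%E ->
  (lp_seminorm r (f + g)%R <= (a + b)%:E)%E.
Proof.
move=> r1 a0 b0; have r0 : 0 < r by apply: lt_le_trans r1.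
have ab0 : 0 < a + b by rewrite addr_gt0.
rewrite !lp_seminorm_le ?(ltW a0) ?(ltW b0) ?(ltW ab0)// => fa gb.
pose c1 := (a + b) `^ r * (a / (a + b)) / (a `^ r).
pose c2 := (a + b) `^ r * (b / (a + b)) / (b `^ r).
have c10 : 0 <= c1 by rewrite !mulr_ge0 ?invr_ge0 ?powR_ge0 ?ltW.
have c20 : 0 <= c2 by rewrite !mulr_ge0 ?invr_ge0 ?powR_ge0 ?ltW.
apply: (@le_trans _ _ (c1%:E * lp_sum r f + c2%:E * lp_sum r g)%E).
  apply: (@le_trans _ _ (\esum_(A in [set: AA])
      (c1%:E * (`|f (Some (psi_set A))| `^ r)%:E +
       c2%:E * (`|g (Some (psi_set A))| `^ r)%:E))%E).
    apply: le_esum => A _; rewrite -!EFinM -EFinD lee_fin.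
    apply: le_trans (lp_convex r1 a0 b0 (normr_ge0 _) (normr_ge0 _)).
    apply: (ge0_ler_powR (ltW r0)); rewrite ?nnegrE ?addr_ge0//.
    exact: ler_normD.
  rewrite esumD; [|by move=> A _; rewrite -EFinM lee_fin mulr_ge0 ?powR_ge0..].
  by apply: leeD; apply: esumZ_le => // A; rewrite lee_fin powR_ge0.
apply: (@le_trans _ _ (c1%:E * (a `^ r)%:E + c2%:E * (b `^ r)%:E)%E).
  by apply: leeD; apply: lee_wpmul2l; rewrite ?lee_fin.
rewrite -!EFinM -EFinD lee_fin /c1 /c2 !divfK ?gt_eqF ?powR_gt0//.
by rewrite -mulrDr -mulrDl divff ?gt_eqF// mulr1.
Qed.

Lemma lp_seminorm_fin r f : (lp_seminorm r f < +oo)%E ->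
  lp_seminorm r f = (fine (lp_seminorm r f))%:E.
Proof.
by move=> fy; rewrite fineK// ge0_fin_numE// lp_seminorm_ge0.
Qed.

Lemma lp_seminorm0 r : 0 < r -> lp_seminorm r (0 : KA AA -> R^o) = 0%E.
Proof.
move=> r0; rewrite /lp_seminorm /lp_sum esum1 ?poweR0r ?invr_eq0 ?gt_eqF//.
by move=> A _; rewrite normr0 powR0// gt_eqF.
Qed.

Lemma lp_seminormD_fine r f g : 1 <= r ->
  (lp_seminorm r f < +oo)%E -> (lp_seminorm r g < +oo)%E ->
  (lp_seminorm r (f + g)%R <=
     (fine (lp_seminorm r f) + fine (lp_seminorm r g))%:E)%E.
Proof.
move=> r1 fy gy; apply/lee_addgt0Pr => e e0.
have e20 : 0 < e / 2 by rewrite divr_gt0.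
have -> : ((fine (lp_seminorm r f) + fine (lp_seminorm r g))%:E + e%:E =
  ((fine (lp_seminorm r f) + e / 2) + (fine (lp_seminorm r g) + e / 2))%:E)%E.
  by rewrite -EFinD; congr (_%:E); field.
apply: lp_seminormD => //.
- by rewrite ltr_wpDl// fine_ge0// lp_seminorm_ge0.
- by rewrite ltr_wpDl// fine_ge0// lp_seminorm_ge0.
- by rewrite [leLHS]lp_seminorm_fin// lee_fin lerDl ltW.
- by rewrite [leLHS]lp_seminorm_fin// lee_fin lerDl ltW.
Qed.

Lemma JL_submod_closed p : (1 < p)%E -> submod_closed (JL_pred p).
Proof.
move=> p1; split.
  rewrite inE; split; first exact: cst_continuous.
  by case: p p1 => // r; rewrite lte_fin => r1; rewrite lp_seminorm0// (lt_trans _ r1).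
move=> l f g; rewrite !inE => -[cf Ff] [cg Fg]; split.
  by move=> x; have h := cvgD (cvgZl_tmp (k := l) (cf x)) (cg x); exact: h.
case: p p1 Ff Fg => // r; rewrite lte_fin => r1 fy gy.
have r0 : 0 < r by exact: lt_trans r1.
have lfy : (lp_seminorm r (l *: f)%R < +oo)%E.
  apply: (le_lt_trans (@lp_seminormZ r l f (fine (lp_seminorm r f)) r0 _ _)).
  - by rewrite fine_ge0// lp_seminorm_ge0.
  - by rewrite -lp_seminorm_fin.
  - by rewrite ltry.
by apply: le_lt_trans (lp_seminormD_fine (ltW r1) lfy gy) _; rewrite ltry.
Qed.

Lemma JL_norm_ge0 p f : JL_set p f -> 0 <= JL_norm p f.
Proof.
move=> [cf _]; have := supnorm_ge0 cf.
by case: p => // r sf; rewrite le_max sf.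
Qed.

Lemma JL_norm_eq0 p f : JL_set p f -> JL_norm p f = 0 -> f = 0.
Proof.
move=> [cf _] f0; apply/funext => x; apply/eqP; rewrite -normr_le0.
apply: le_trans (supnorm_ub x cf) _; rewrite -f0.
by case: p f0 => // r _; rewrite le_max lexx.
Qed.

Lemma JL_normD p f g : (1 < p)%E -> JL_set p f -> JL_set p g ->
  JL_norm p (f + g) <= JL_norm p f + JL_norm p g.
Proof.
move=> p1 [cf Ff] [cg Fg].
have sD : supnorm (f + g) <= supnorm f + supnorm g.
  by apply: supnorm_le => x; apply: (le_trans (ler_normD _ _));
    apply: lerD; exact: supnorm_ub.
case: p p1 Ff Fg => //= r; rewrite lte_fin => r1 fy gy.
rewrite ge_max; apply/andP; split.
  by apply: (le_trans sD); apply: lerD; rewrite le_max lexx.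
have fg := lp_seminormD_fine (ltW r1) fy gy.
have fgy := le_lt_trans fg (ltry _).
apply: (@le_trans _ _ (fine (lp_seminorm r f) + fine (lp_seminorm r g))).
  by rewrite -lee_fin -lp_seminorm_fin.
by apply: lerD; rewrite le_max lexx orbT.
Qed.

Lemma JL_normZ_le p (l : R) f : (1 < p)%E -> JL_set p f ->
  JL_norm p (l *: f) <= `|l| * JL_norm p f.
Proof.
move=> p1 [cf Ff].
have sZ : supnorm (l *: f) <= `|l| * supnorm f.
  by apply: supnorm_le => x; rewrite normrZ ler_wpM2l// supnorm_ub.
case: p p1 Ff => //= r; rewrite lte_fin => r1 fy.
have r0 : 0 < r by exact: lt_trans r1.
rewrite ge_max; apply/andP; split.
  by apply: (le_trans sZ); rewrite ler_wpM2l// le_max lexx.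
apply: (@le_trans _ _ (`|l| * fine (lp_seminorm r f))); last first.
  by rewrite ler_wpM2l// le_max lexx orbT.
have lf : (lp_seminorm r (l *: f) <= (`|l| * fine (lp_seminorm r f))%:E)%E.
  apply: lp_seminormZ => //; first by rewrite fine_ge0// lp_seminorm_ge0.
  by rewrite -lp_seminorm_fin.
by rewrite -lee_fin -lp_seminorm_fin// (le_lt_trans lf) ?ltry.
Qed.

End JL_norm.

Record JL (R : realType) (p : \bar R) (p1 : (1 < p)%E)
    (N : countType) (AA : set (set N)) := MkJL {
  JL_fun :> KA AA -> R^o;
  JL_funP : JL_fun \in @JL_pred R N AA p
}.

Section JL_normed_module.
Context (R : realType) (p : \bar R) (p1 : (1 < p)%E)
  (N : countType) (AA : set (set N)).

HB.instance Definition _ := [isSub for @JL_fun R p p1 N AA].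
HB.instance Definition _ := gen_eqMixin (JL p1 AA).
HB.instance Definition _ := gen_choiceMixin (JL p1 AA).
HB.instance Definition _ := GRing.isSubmodClosed.Build _ _
  (@JL_pred R N AA p) (JL_submod_closed AA p1).
HB.instance Definition _ := [SubChoice_isSubLmodule of JL p1 AA by <:].

Let nm (f : JL p1 AA) : R := JL_norm p f.

Let JLP (f : JL p1 AA) : JL_set p f.
Proof. exact: set_mem (JL_funP f). Qed.

Let nmD (f g : JL p1 AA) : nm (f + g) <= nm f + nm g.
Proof. exact: (JL_normD p1 (JLP f) (JLP g)). Qed.

Let nmZ (l : R) (f : JL p1 AA) : nm (l *: f) = `|l| * nm f.
Proof.
have le_nmZ k h : nm (k *: h) <= `|k| * nm h by exact: (JL_normZ_le k p1 (JLP h)).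
apply/le_anti; rewrite le_nmZ/=; have [->|l0] := eqVneq l 0.
  by rewrite normr0 mul0r JL_norm_ge0.
by rewrite -ler_pdivlMl ?normr_gt0// -normfV -{1}[f](scalerK l0) le_nmZ.
Qed.

Let nm_eq0 (f : JL p1 AA) : nm f = 0 -> f = 0.
Proof. by move=> /(JL_norm_eq0 (JLP f)) f0; exact: val_inj. Qed.

HB.instance Definition _ := @Lmodule_isNormed.Build R (JL p1 AA) nm nmD nmZ nm_eq0.

End JL_normed_module.

Lemma JL_normE (R : realType) (p : \bar R) (p1 : (1 < p)%E)
  (N : countType) (AA : set (set N)) (f : JL p1 AA) : `|f| = JL_norm p f.
Proof. by []. Qed.

(* The range of [T] is the linear subspace; [S] restricted to it is the inverse
   of the isomorphism [T]. *)
Definition isomorphic_to_subspace (R : realType) (X Y : normedModType R) : Prop :=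
  exists (T : {linear X -> Y}) (S : Y -> X),
    [/\ continuous T, cancel T S & {within range T, continuous S}].

Definition is_tree (T : set (seq nat)) : Prop :=
  T [::] /\ forall s t : seq nat, prefix s t -> T t -> T s.

Definition immediate_successors (T : set (seq nat)) (s : seq nat) : set (seq nat) :=
  [set t | T t /\ exists k, t = rcons s k].

Definition tree_body (T : set (seq nat)) : set (nat -> nat) :=
  [set x | forall n, T (mkseq x n)].

(* Branches are sets of nodes of [T], i.e. subsets of the subtype [T] of
   [seq nat], so that the isolated points of [psi (branches T)] are exactly
   the nodes of [T]. *)
Definition branch (T : set (seq nat)) (x : nat -> nat) : set T :=
  [set s : T | exists n, val s = mkseq x n].

Arguments branch T x : clear implicits.

Definition branches (T : set (seq nat)) : set (set T) :=
  branch T @` tree_body T.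

Arguments branches T : clear implicits.

Definition dyadic_tree : set (seq nat) := [set s | all (fun k => (k < 2)%N) s].

Definition almost_disjoint (N : countType) (AA : set (set N)) : Prop :=
  (forall A, AA A -> infinite_set A) /\
  (forall A B, AA A -> AA B -> A <> B -> finite_set (A `&` B)).

Lemma branches_almost_disjoint (T : set (seq nat)) :
  almost_disjoint (branches T).
Proof.
split=> [_ [x xT <-]|_ _ [x xT <-] [y yT <-] xy].
- pose u n : T := exist _ (mkseq x n) (mem_set (xT n)).
  have uI : injective u.
    by move=> m n /(congr1 (fun s : T => size (val s)))/=; rewrite !size_mkseq.
  move=> finB; apply: infinite_nat.
  apply: sub_finite_set (finite_preimage (in2W uI) finB) => n _.
  by exists n.
- have [m xym] : exists m, x m <> y m.
    apply: contrapT => /forallNP xyE; apply: xy; congr branch.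
    by apply/funext => m; exact: contrapT (xyE m).
  have fin : finite_set (mkseq x @` `I_m.+1) by exact/finite_image/finite_II.
  have vI : injective (val : T -> seq nat) := val_inj.
  apply: sub_finite_set (finite_preimage (in2W vI) fin) => s [[n sx] [k sy]].
  exists n => //=; rewrite ltnS leqNgt; apply/negP => mn; apply: xym.
  have kn : k = n by rewrite -(size_mkseq x n) -sx sy size_mkseq.
  by rewrite -(nth_mkseq 0%N x mn) -sx sy nth_mkseq// kn.
Qed.

(* Main.v *)
(* For a branch x let f_x be the indicator function of B(x), and let
   T : JL_p(A_Upsilon) -> JL_p(A_2) be an embedding.  Put g_x = T f_x - (T f_x)(oo).
   Boundedness of T gives, at each dyadic node t, an l_1 functional (a_t(s))_s with
   g_x(t) = sum_n a_t(x|n) for all but countably many x, so g_x(t) is continuous in x.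
   As T is bounded below and the functions vanishing off a countable set of branches
   form a separable space, for all but countably many x there is a dyadic branch y_x on
   which |g_x| >= eps eventually while a_{y_x|n}(s) -> 0 for every s; by Baire the
   constants can be taken uniform on a dense subset of a cylinder [s0].  At a node s of
   Upsilon with very many successors k choose such x_k through s^k.  At each t at most
   M values g_{x_k}(t) differ essentially from h(t) = sum_{n <= |s|} a_t(s|n), hence h is
   large wherever more than M of the y_{x_k} pass.  As there are only 2^N dyadic nodes of
   level N, more than 3M of the y_{x_k} share one, and they branch off above it, at most M
   at a time; some g_{x_k} is then large at two incomparable nodes above level N.
   Iterating, g_x is large on arbitrarily long antichains for all x in a subcylinder,
   whereas continuity of T f_x on the compactification bounds the antichains on which it
   is far from its value at oo. *)
Require Import Defs.
From mathcomp Require Import all_boot all_order all_algebra.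
From mathcomp Require Import all_classical all_reals all_analysis.
From mathcomp Require Import zify lra.

Set Implicit Arguments.
Unset Strict Implicit.
Unset Printing Implicit Defensive.

Import Order.TTheory GRing.Theory Num.Theory.
Import numFieldNormedType.Exports.

Local Open Scope classical_set_scope.
Local Open Scope ring_scope.

(** * Trees and antichains *)

(** The cylinder of [s], as a boolean relation so that sequences through a node can be counted. *)
Definition passes (s : seq nat) (x : nat -> nat) : bool := mkseq x (size s) == s.

Lemma take_mkseq (x : nat -> nat) m n : (m <= n)%N ->
  take m (mkseq x n) = mkseq x m.
Proof. by move=> mn; rewrite /mkseq -map_take take_iota (minn_idPl mn). Qed.

Lemma prefix_mkseq (x : nat -> nat) m n : (m <= n)%N ->
  prefix (mkseq x m) (mkseq x n).
Proof. by move=> mn; rewrite prefixE size_mkseq take_mkseq. Qed.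

Lemma passes_mkseq (x : nat -> nat) n : passes (mkseq x n) x.
Proof. by rewrite /passes size_mkseq. Qed.

Lemma passes_prefix (s t : seq nat) x : prefix s t -> passes t x -> passes s x.
Proof.
move=> /[dup] /size_prefix st; rewrite prefixE => /eqP <- /eqP {1}<-.
by rewrite take_mkseq// passes_mkseq.
Qed.

Lemma prefix_passes (s t : seq nat) x : passes s x -> passes t x ->
  (size s <= size t)%N -> prefix s t.
Proof. by move=> /eqP <- /eqP <-; rewrite !size_mkseq; exact: prefix_mkseq. Qed.

Lemma passes_rcons (s : seq nat) k x : passes (rcons s k) x -> x (size s) = k.
Proof.
move=> /eqP /(congr1 (last 0%N)); rewrite last_rcons => <-.
by rewrite size_rcons mkseqS last_rcons.
Qed.

(* A Baire category argument in the space of branches of a pruned tree. *)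
Lemma dense_on_cylinder (U : set (seq nat)) (I : countType)
    (H : I -> set (nat -> nat)) : is_tree U ->
  (forall s, U s -> exists k, U (rcons s k)) ->
  (forall x, tree_body U x -> exists i, H i x) ->
  exists i s, U s /\ forall s', U s' -> prefix s s' ->
    exists x, [/\ tree_body U x, passes s' x & H i x].
Proof.
move=> [U0 Upre] Usucc cov; apply: contrapT => nd.
(* If the conclusion fails, every [H i] is nowhere dense: each node [s] extends to a node [F (i, s)]
   whose cylinder misses [H i]. *)
have /choice[F FP] : forall q : I * seq nat, exists s', U q.2 ->
    [/\ U s', prefix q.2 s' &
      forall x, tree_body U x -> passes s' x -> ~ H q.1 x].
  move=> [i s] /=; have [Us|nUs] := pselect (U s); last by exists [::].
  apply: contrapT => no; apply: nd; exists i, s; split=> // s' Us' ss'.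
  apply: contrapT => nx; apply: no; exists s' => _; split=> // x bx sx Hx.
  by apply: nx; exists x.
have /choice[k kP] : forall s, exists k, U s -> U (rcons s k).
  move=> s.
  by have [/Usucc[k]|] := pselect (U s); [exists k|exists 0%N].
(* Stage [n] avoids the [H i] with code [n], if there is one; [sq] then appends a successor, which
   forces the lengths to infinity. *)
pose G n s := if unpickle n is Some i then F (i, s) else s.
pose sq := fix sq n := if n is n'.+1 then rcons (G n' (sq n')) (k (G n' (sq n'))) else [::].
have GP n s : U s -> U (G n s) /\ prefix s (G n s).
  by move=> Us; rewrite /G; case: unpickle => [i|]; [have [] := FP (i, s) Us|rewrite prefix_refl].
have Usq n : U (sq n).
  by elim: n => //= n IH; apply: kP; have [] := GP n _ IH.
have Gsq n : prefix (G n (sq n)) (sq n.+1) by rewrite /= prefix_rcons.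
have sqS n : prefix (sq n) (sq n.+1).
  by apply: prefix_trans (Gsq n); have [] := GP n _ (Usq n).
have sqle m n : (m <= n)%N -> prefix (sq m) (sq n).
  elim: n => [|n IH]; first by rewrite leqn0 => /eqP ->; exact: prefix_refl.
  rewrite leq_eqVlt => /orP[/eqP ->|]; first exact: prefix_refl.
  rewrite ltnS => /IH h.
  exact: prefix_trans h (sqS n).
have szS n : (size (sq n) < size (sq n.+1))%N.
  have [_ /size_prefix h] := GP n _ (Usq n).
  by rewrite /= size_rcons ltnS.
have sz n : (n <= size (sq n))%N.
  by elim: n => // n IH; exact: leq_ltn_trans IH (szS n).
(* The limit of the nodes [sq n]. As [sq n.+1] has length above [n], the default of [nth] is never
   reached. *)
pose x n := nth 0%N (sq n.+1) n.
have sqx n : passes (sq n) x.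
  apply/eqP; apply: (@eq_from_nth _ 0%N); rewrite size_mkseq// => i isz.
  rewrite nth_mkseq// /x; have [h|h] := leqP n i.
    have /prefixP[w ->] := sqle n i.+1 (leqW h).
    by rewrite nth_cat isz.
  have /prefixP[w ->] := sqle i.+1 n h.
  by rewrite nth_cat sz.
have bx : tree_body U x.
  move=> n; apply: Upre (Usq n); apply: prefix_passes (passes_mkseq x n) (sqx n) _.
  by rewrite size_mkseq.
have [i Hix] := cov x bx.
have [_ _ /(_ x bx) h] := FP (i, sq (pickle i)) (Usq _).
apply: h Hix => /=; apply: passes_prefix (sqx (pickle i).+1).
by have := Gsq (pickle i); rewrite {1}/G pickleK.
Qed.

Definition antichain (L : seq (seq nat)) : Prop :=
  uniq L /\ {in L &, forall t t', prefix t t' -> t = t'}.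

Lemma sub_in_count (T : eqType) (P Q : pred T) (s : seq T) :
  {in s, forall x, P x -> Q x} -> (count P s <= count Q s)%N.
Proof.
move=> PQ; rewrite (@eq_in_count _ P (predI P Q)).
  by apply: sub_count => x /andP[].
by move=> x /PQ /=; case: (P x) => // ->.
Qed.

Lemma count_le1 (T : eqType) (P : pred T) (s : seq T) : uniq s ->
  {in s &, forall x y, P x -> P y -> x = y} -> (count P s <= 1)%N.
Proof.
move=> us Ps; rewrite -size_filter.
have : uniq (seq.filter P s) by exact: filter_uniq.
have : {subset seq.filter P s <= s} by move=> x; rewrite mem_filter => /andP[].
have : all P (seq.filter P s) by exact: filter_all.
case: seq.filter => [|x [|y r]]//= /and3P[Px Py _] rs.
have xs : x \in s by apply: rs; rewrite mem_head.
have ys : y \in s by apply: rs; rewrite !inE eqxx orbT.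
by rewrite (Ps _ _ xs ys Px Py) mem_head.
Qed.

(** Repeated halving: one of the two values at each level is shared by at least half of the
    sequences left, so the induction hypothesis is used with [Q * 2]. *)
Lemma binary_pigeonhole (K : seq nat) (y : nat -> nat -> nat) Q N :
  uniq K -> (forall k n, k \in K -> (y k n < 2)%N) -> (Q * 2 ^ N < size K)%N ->
  exists u K', [/\ size u = N, uniq K', {subset K' <= K}, (Q < size K')%N &
    {in K', forall k, passes u (y k)}].
Proof.
elim: N Q => [|N IH] Q uK y2; first by rewrite expn0 muln1 => QK; exists [::], K; split.
rewrite expnS mulnA => /(IH _ uK y2)[u [K' [su uK' K'K QK' pu]]].
pose f b := [seq k <- K' | y k N == b].
have ss : size K' = (size (f 0%N) + size (f 1%N))%N.
  rewrite -(count_predC (fun k => y k N == 0%N) K') !size_filter; congr (_ + _)%N.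
  by apply: eq_in_count => k /K'K kK /=; have := y2 k N kK; case: (y k N) => [|[]].
have [b Qb] : exists b, (Q < size (f b))%N.
  have [h|h] := ltnP Q (size (f 0%N)); first by exists 0%N.
  by exists 1%N; lia.
exists (rcons u b), (f b); split=> //.
- by rewrite size_rcons su.
- exact: filter_uniq.
- by move=> k; rewrite mem_filter => /andP[_ /K'K].
- move=> k; rewrite mem_filter => /andP[/eqP ykb /pu /eqP h].
  by rewrite /passes size_rcons mkseqS h su ykb.
Qed.

(* Splitting one level at a time, [v] is the first node through which at most
   [2 * M] of the sequences pass. *)
Lemma binary_split (K : seq nat) (y : nat -> nat -> nat) M u :
  (forall k n, k \in K -> (y k n < 2)%N) ->
  (2 * M < count (fun k => passes u (y k)) K)%N ->
  (exists n0, forall t, (n0 <= size t)%N -> (count (fun k => passes t (y k)) K <= M)%N) ->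
  exists v, [/\ prefix u v, (M < count (fun k => passes v (y k)) K)%N &
    (count (fun k => passes v (y k)) K <= 2 * M)%N].
Proof.
move=> y2 Ku [n0 n0P]; pose c t := count (fun k => passes t (y k)) K.
have [//|nov] := pselect (exists v, [/\ prefix u v, (M < c v)%N & (c v <= 2 * M)%N]).
(* Without such a [v], a node met by more than [2 * M] sequences has a child met by more than [M],
   hence by more than [2 * M]. Descending [n0] levels contradicts the last hypothesis. *)
have step d : exists v, [/\ prefix u v, size v = (size u + d)%N & (2 * M < c v)%N].
  elim: d => [|d [v [uv sv cv]]]; first by exists u; rewrite addn0 prefix_refl.
  have cS : (c v <= c (rcons v 0) + c (rcons v 1))%N.
    rewrite /c -count_predUI; apply: leq_trans (leq_addr _ _).
    apply: sub_in_count => k kK /eqP pv /=.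
    have := y2 k (size v) kK; rewrite /passes !size_rcons !mkseqS pv.
    by case: (y k (size v)) => [|[]]// _; rewrite eqxx ?orbT.
  have [b Mb] : exists b, (M < c (rcons v b))%N.
    have [h|h] := ltnP M (c (rcons v 0%N)); first by exists 0%N.
    by exists 1%N; lia.
  have ub : prefix u (rcons v b) by apply: prefix_trans uv _; rewrite prefix_rcons.
  exists (rcons v b); split=> //; first by rewrite size_rcons sv addnS.
  by rewrite ltnNge; apply/negP => h; apply: nov; exists (rcons v b).
have [v [_ sv cv]] := step n0; have := n0P v; rewrite -/(c v) sv leq_addl.
by move=> /(_ isT); lia.
Qed.

Lemma prefix_size_eq (s t : seq nat) : prefix s t -> (size t <= size s)%N -> s = t.
Proof. by rewrite prefixE => /eqP st /take_oversize; rewrite st. Qed.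

Lemma prefix_comparable (s t u : seq nat) : prefix s u -> prefix t u ->
  (size s <= size t)%N -> prefix s t.
Proof.
rewrite !prefixE => /eqP su /eqP tu st; apply/eqP.
by rewrite -tu take_takel// su.
Qed.

(** At most one member of [L] is an initial segment of [u], since two would be comparable. Dropping
    it and adding [v] and [w] gains one node; the length bound on [L] keeps the remaining nodes
    incomparable with the new ones. *)
Lemma antichain_extend (L : seq (seq nat)) u v w : antichain L ->
  {in L, forall t, (size t <= size u)%N} -> prefix u v -> prefix u w ->
  size v = size w -> v <> w ->
  exists L', [/\ antichain L', (size L < size L')%N &
    {in L', forall t, t \in L \/ t = v \/ t = w}].
Proof.
move=> [uL aL] Lu uv uw svw vw.
pose F := [seq t <- L | ~~ prefix t u].
have FP z t : prefix u z -> t \in F -> ~~ prefix z t /\ ~~ prefix t z.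
  rewrite mem_filter => uz /andP[tu /Lu ts]; split; apply: contra tu => h.
    have <- : u = t by apply: prefix_size_eq ts; exact: prefix_trans uz h.
    exact: prefix_refl.
  exact: prefix_comparable h uz ts.
have Fz z : prefix u z -> z \notin F.
  by move=> uz; apply/negP => /(FP _ _ uz)[]; rewrite prefix_refl.
have LF : (size L <= (size F).+1)%N.
  rewrite size_filter -(count_predC (fun t => prefix t u)) addnC -addn1 leq_add2l.
  apply: count_le1 => // t1 t2 t1L t2L t1u t2u.
  have [h|/ltnW h] := leqP (size t1) (size t2).
    by apply: aL => //; exact: prefix_comparable t2u h.
  by apply/esym/aL => //; exact: prefix_comparable t1u h.
exists [:: v, w & F]; split; last first.
- move=> t; rewrite !inE => /or3P[/eqP ->|/eqP ->|]; [by right; left|by right; right|].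
  by rewrite mem_filter => /andP[_]; left.
- by rewrite /= !ltnS.
split.
  by rewrite /= inE negb_or !Fz// filter_uniq// !andbT; apply/eqP.
move=> t t'; rewrite !inE => /or3P[/eqP->|/eqP->|tF] /or3P[/eqP->|/eqP->|t'F]//.
- by move=> /prefix_size_eq; rewrite svw; exact.
- by have [/negP] := FP v _ uv t'F.
- by move=> /prefix_size_eq; rewrite svw => /(_ (leqnn _)).
- by have [/negP] := FP w _ uw t'F.
- by have [_ /negP] := FP v _ uv tF.
- by have [_ /negP] := FP w _ uw tF.
- by move: tF t'F; rewrite !mem_filter => /andP[_ tL] /andP[_ t'L]; exact: aL.
Qed.

(** [S0] is chosen with sum within [eta] of the supremum of all finite sums; a disjoint list of sum
    at least [eta] would then exceed the supremum. *)
Lemma summable_tail (R : realType) (I : eqType) (P : I -> Prop) (b : I -> R) (C eta : R) :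
  (forall S : seq I, uniq S -> {in S, forall s, P s} -> \sum_(s <- S) b s <= C) -> 0 < eta ->
  exists S0 : seq I, forall S : seq I, uniq S -> {in S, forall s, P s} ->
    {in S, forall s, s \notin S0} -> \sum_(s <- S) b s < eta.
Proof.
move=> bC eta0.
pose V := [set r : R | exists S : seq I, [/\ uniq S, {in S, forall s, P s} &
  r = \sum_(s <- S) b s]].
have supV : has_sup V.
  split; first by exists 0, [::]; rewrite big_nil.
  by exists C => _ [S [uS SU ->]]; exact: bC.
have [_ [S0 [uS0 S0U ->]] hS0] := sup_adherent eta0 supV.
exists S0 => S uS SU Sl.
have : \sum_(s <- S0 ++ S) b s <= sup V.
  apply: ub_le_sup; first by case: supV.
  exists (S0 ++ S); split=> //; last by move=> s; rewrite mem_cat => /orP[/S0U|/SU].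
  by rewrite cat_uniq uS0 uS andbT /=; apply/hasPn => s /Sl.
by rewrite big_cat /=; move: hS0; lra.
Qed.

(** * The combinatorial contradiction, for abstract coefficients [a t s] and functions [g x t] *)

Section branching.
Context (R : realType) (U : set (seq nat)) (a : seq nat -> seq nat -> R) (C : R)
  (g : (nat -> nat) -> seq nat -> R) (D : set (nat -> nat)).
Hypothesis (U_tree : is_tree U)
  (U_branching : forall s k, U s -> exists s' L,
    [/\ prefix s s', uniq L, (k <= size L)%N & {in L, forall i, U (rcons s' i)}])
  (a_bounded : forall t S, uniq S -> {in S, forall s, U s} ->
    \sum_(s <- S) `|a t s| <= C)
  (D_countable : countable D)
  (g_sum : forall x, tree_body U x -> ~ D x -> forall t (eta : R), 0 < eta ->
    exists l0, forall l, (l0 <= l)%N ->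
      `|g x t - \sum_(0 <= n < l) a t (mkseq x n)| < eta)
  (g_far : forall x, tree_body U x -> ~ D x -> exists y : nat -> nat,
    [/\ forall n, (y n < 2)%N,
      exists m, forall n, (m <= n)%N -> m.+1%:R^-1 <= `|g x (mkseq y n)| &
      forall s, U s -> forall eta : R, 0 < eta -> exists n0, forall n, (n0 <= n)%N ->
        `|a (mkseq y n) s| < eta])
  (g_antichain : forall x, tree_body U x -> ~ D x -> forall delta : R, 0 < delta ->
    exists j, forall L, antichain L -> {in L, forall t, delta <= `|g x t|} ->
      (size L <= j)%N).

Let segment (x : nat -> nat) l l' := [seq mkseq x n | n <- index_iota l l'].

Let segment_uniq x l l' : uniq (segment x l l').
Proof.
rewrite map_inj_uniq ?iota_uniq// => i j /(congr1 size).
by rewrite !size_mkseq.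
Qed.

Let segment_U x l l' : tree_body U x -> {in segment x l l', forall s, U s}.
Proof. by move=> bx s /mapP[n _ ->]. Qed.

Let sum_segment x l l' t :
  \sum_(s <- segment x l l') a t s = \sum_(l <= n < l') a t (mkseq x n).
Proof. by rewrite big_map. Qed.

(** All but [eta] of the mass of [a t] sits on finitely many nodes, whose lengths are bounded. *)
Lemma small_tail t eta : 0 < eta -> exists l, forall S, uniq S ->
  {in S, forall s, U s} -> {in S, forall s, (l <= size s)%N} ->
  \sum_(s <- S) `|a t s| < eta.
Proof.
move=> eta0; have [S0 S0P] := summable_tail (P := U) (a_bounded t) eta0.
exists (\max_(s <- S0) size s).+1 => S uS SU Sl; apply: S0P => // s /Sl.
by apply: contraL => sS0; rewrite -leqNgt; exact: (@leq_bigmax_seq _ _ xpredT).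
Qed.

Let body_g x := tree_body U x /\ ~ D x.

(** Branches that agree up to level [l] have the same partial sums up to [l], and [small_tail]
    bounds what comes later uniformly over all branches. *)
Lemma g_continuous x t eta : body_g x -> 0 < eta -> exists l, forall x',
  body_g x' -> passes (mkseq x l) x' -> `|g x t - g x' t| < eta.
Proof.
move=> [bx Dx] eta0; have eta40 : 0 < eta / 4 by rewrite divr_gt0.
have [l lP] := small_tail t eta40; exists l => x' [bx' Dx'] /eqP.
rewrite size_mkseq => xx'.
have tail z l' : tree_body U z -> `|\sum_(l <= n < l') a t (mkseq z n)| < eta / 4.
  move=> bz; rewrite -sum_segment; apply: le_lt_trans (ler_norm_sum _ _ _) _.
  apply: lP; [exact: segment_uniq|exact: segment_U|].
  by move=> s /mapP[n]; rewrite mem_index_iota => /andP[ln _] ->; rewrite size_mkseq.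
have [l1 h1] := g_sum bx Dx t eta40; have [l2 h2] := g_sum bx' Dx' t eta40.
pose l' := maxn l (maxn l1 l2).
have {}h1 := h1 l' _; have {}h2 := h2 l' _.
have ll' : (l <= l')%N by rewrite leq_maxl.
have := h1 ltac:(lia); have := h2 ltac:(lia).
have := tail x l' bx; have := tail x' l' bx'.
rewrite !(big_cat_nat (leq0n l) ll') /=.
have -> : \sum_(0 <= n < l) a t (mkseq x' n) = \sum_(0 <= n < l) a t (mkseq x n).
  rewrite big_nat [RHS]big_nat; apply: eq_bigr => n nl.
  by rewrite -(take_mkseq x (ltnW nl)) -xx' take_mkseq // ltnW.
rewrite !ltr_norml; lra.
Qed.

(* The partial sum [a t] along [s'] determines, up to [eta], the values at [t]
   of [g] on all but boundedly many of the branches splitting at [s']. *)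
Lemma few_exceptions (eta : R) : 0 < eta -> exists M, forall s' (K : seq nat)
    (x : nat -> nat -> nat) t, uniq K ->
  {in K, forall k, body_g (x k) /\ passes (rcons s' k) (x k)} ->
  (count (fun k => (eta <= `|g (x k) t - \sum_(0 <= n < (size s').+1) a t (take n s')|)%R) K
    <= M)%N.
Proof.
move=> eta0; have eta20 : 0 < eta / 2 by rewrite divr_gt0.
(* Each exceptional [k] will force mass at least [eta / 2] of [a t] onto the part of [x k] beyond
   [s'], and these parts are disjoint. *)
have [M CM] : exists M : nat, C < M%:R * (eta / 2).
  exists (Num.truncn (C / (eta / 2))).+1; rewrite -ltr_pdivrMr//.
  exact: truncnS_gt.
exists M => s' K x t uK Kx; rewrite -size_filter leqNgt; apply/negP.
set K' := seq.filter _ K => MK'.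
have uK' : uniq K' by exact: filter_uniq.
have K'x k : k \in K' -> [/\ tree_body U (x k), ~ D (x k), passes (rcons s' k) (x k) &
    eta <= `|g (x k) t - \sum_(0 <= n < (size s').+1) a t (take n s')|].
  by rewrite mem_filter => /andP[h /Kx[[]]].
have [l lP] : exists l, {in K', forall k, forall l', (l <= l')%N ->
    `|g (x k) t - \sum_(0 <= n < l') a t (mkseq (x k) n)| < eta / 2}.
  elim: (K') K'x => [|k K0 IH] Kh; first by exists 0%N.
  have [l1 h1] : exists l, {in K0, forall k, forall l', (l <= l')%N ->
    `|g (x k) t - \sum_(0 <= n < l') a t (mkseq (x k) n)| < eta / 2}.
    by apply: IH => k' k'K; apply: Kh; rewrite inE k'K orbT.
  have [bk Dk _ _] := Kh k (mem_head _ _).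
  have [l2 h2] := g_sum bk Dk t eta20.
  exists (maxn l1 l2) => k'; rewrite inE => /orP[/eqP ->|k'K] l'.
    by rewrite geq_max => /andP[_]; exact: h2.
  by rewrite geq_max => /andP[+ _]; exact: h1.
(* Below level [q] all [x k] run along [s']; from [q] on they pass through different successors of
   [s'], so the segments are disjoint. *)
pose q := (size s').+1; pose l' := maxn l q.
have uS : uniq (flatten [seq segment (x k) q l' | k <- K']).
  elim: (K') uK' K'x => //= k K0 IH /andP[kK0 uK0] K0x.
  rewrite cat_uniq segment_uniq IH//; last first.
    by move=> k' k'K; apply: K0x; rewrite inE k'K orbT.
  rewrite andbT /=; apply/hasPn => s /flatten_mapP[k' kK /mapP[n]].
  rewrite mem_index_iota => /andP[qn _] ->; apply/negP => /mapP[n' _ e].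
  have nn : n = n' by move/(congr1 size): e; rewrite !size_mkseq.
  have [_ _ pk _] := K0x k (mem_head _ _).
  have [_ _ pk' _] := K0x k' (mem_behead (s := k :: K0) kK).
  move/(congr1 (nth 0%N ^~ (size s'))): e; rewrite -nn !nth_mkseq//.
  by rewrite (passes_rcons pk) (passes_rcons pk') => kk; move: kK0; rewrite -kk kK.
pose S := flatten [seq segment (x k) q l' | k <- K'].
have memS s : s \in S -> exists2 k, k \in K' & exists2 n, (q <= n)%N & s = mkseq (x k) n.
  move=> /flatten_mapP[k kK /mapP[n]]; rewrite mem_index_iota => /andP[qn _] ->.
  by exists k => //; exists n.
have SU : {in S, forall s, U s}.
  by move=> s /memS[k /K'x[bk _ _ _] [n _ ->]].
have := a_bounded t uS SU; apply/negP; rewrite -ltNge.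
apply: (lt_le_trans CM); rewrite big_flatten big_map /=.
apply: (@le_trans _ _ (\sum_(k <- K') eta / 2)).
  rewrite big_const_seq count_predT iter_addr_0 -[leRHS]mulr_natl.
  by rewrite ler_pM2r// ler_nat ltnW.
rewrite big_seq [leRHS]big_seq; apply: ler_sum => k kK.
apply: le_trans (ler_norm_sum _ _ _); rewrite sum_segment.
have [_ _ pk h] := K'x k kK.
have := lP k kK l' (leq_maxl _ _).
have ql' : (q <= l')%N by rewrite leq_maxr.
rewrite (big_cat_nat (leq0n q) ql') /=.
have -> : \sum_(0 <= n < q) a t (mkseq (x k) n) = \sum_(0 <= n < q) a t (take n s').
  rewrite big_nat [RHS]big_nat; apply: eq_bigr => n; rewrite /q ltnS => nl.
  have /eqP e := passes_prefix (prefix_rcons s' k) pk.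
  by rewrite -[in RHS]e take_mkseq.
move: h; rewrite ler_normr ltr_norml => /orP[] h /andP[h1 h2].
  by rewrite ler_normr; apply/orP; left; lra.
by rewrite ler_normr; apply/orP; right; lra.
Qed.

Lemma partial_sum_cvg0 (y : nat -> nat) s' :
  (forall s, U s -> forall eta : R, 0 < eta -> exists n0, forall n, (n0 <= n)%N ->
    `|a (mkseq y n) s| < eta) -> U s' ->
  forall q (eta : R), 0 < eta -> exists n0, forall n, (n0 <= n)%N ->
    `|\sum_(0 <= i < q) a (mkseq y n) (take i s')| < eta.
Proof.
move=> ya Us'; elim=> [|q IH] eta eta0.
  by exists 0%N => n _; rewrite big_geq// normr0.
have eta20 : 0 < eta / 2 by rewrite divr_gt0.
have [n1 h1] := IH _ eta20.
have Uq : U (take q s') by apply: U_tree.2 Us'; exact: prefix_take.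
have [n2 h2] := ya _ Uq _ eta20.
exists (maxn n1 n2) => n; rewrite geq_max => /andP[/h1 {}h1 /h2 {}h2].
rewrite big_nat_recr//=; apply: le_lt_trans (ler_normD _ _) _.
by rewrite [ltRHS](splitr eta) ltrD.
Qed.

(** The property of [g_far] with its constant fixed: one number controls both the starting level and
    the lower bound, which leaves countably many cases for the category argument. *)
Let far_from m x (y : nat -> nat) := [/\ forall n, (y n < 2)%N,
  forall n, (m <= n)%N -> m.+1%:R^-1 <= `|g x (mkseq y n)| &
  forall s, U s -> forall eta : R, 0 < eta -> exists n0, forall n, (n0 <= n)%N ->
    `|a (mkseq y n) s| < eta].

(** One round of the iteration. Many branches leave the cylinder of [s] at a common node [s']; one
    of them has [g] large at two incomparable dyadic nodes [v] and [w] above [L], and continuity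
    carries this over to a smaller cylinder. *)
Lemma larger_antichain m s L :
  (forall s', U s' -> prefix s s' -> exists x,
    [/\ body_g x, passes s' x & exists y, far_from m x y]) ->
  U s -> antichain L ->
  (forall x, body_g x -> passes s x -> {in L, forall t, m.+1%:R^-1 / 4 <= `|g x t|}) ->
  exists s' L', [/\ U s', prefix s s', antichain L', (size L < size L')%N &
    forall x, body_g x -> passes s' x -> {in L', forall t, m.+1%:R^-1 / 4 <= `|g x t|}].
Proof.
move=> dense Us aL Lg; set e : R := m.+1%:R^-1.
have e0 : 0 < e by rewrite invr_gt0 ltr0n.
have e40 : 0 < e / 4 by rewrite divr_gt0.
have [M MP] := few_exceptions e40.
(* Level [N] is high enough for the lower bound in [far_from m] and for the length condition of
   [antichain_extend]. *)
pose N := maxn m (\max_(t <- L) size t).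
have [s' [K0 [ss' uK0 K0M K0U]]] := U_branching (3 * M * 2 ^ N).+1 Us.
have Us' : U s'.
  by case: K0 K0M K0U {uK0} => // k K0 _ /(_ k (mem_head _ _)); apply: U_tree.2; exact: prefix_rcons.
have /choice[xy xyP] : forall k, exists q : (nat -> nat) * (nat -> nat), k \in K0 ->
    [/\ body_g q.1, passes (rcons s' k) q.1 & far_from m q.1 q.2].
  move=> k; have [kK|] := boolP (k \in K0); last by exists (id, id).
  have [|x [bx px [y xy]]] := dense _ (K0U k kK); last by exists (x, y).
  by apply: prefix_trans ss' _; exact: prefix_rcons.
pose x k := (xy k).1; pose y k := (xy k).2.
have y2 k n : k \in K0 -> (y k n < 2)%N by move=> /xyP[_ _ [+ _ _]]; exact.
have [u [K [su uK KK0 KM Ku]]] := binary_pigeonhole uK0 y2 K0M.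
(* The contribution to [g (x k) t] of the nodes up to [s'], common to all [k]. *)
pose h t := \sum_(0 <= n < (size s').+1) a t (take n s').
pose bad t k := e / 4 <= `|g (x k) t - h t|.
have badM t : (count (bad t) K <= M)%N.
  by apply: MP => // k /KK0 /xyP[].
have gK t k : k \in K -> (m <= size t)%N -> passes t (y k) -> e <= `|g (x k) t|.
  move=> /KK0 /xyP[_ _ [_ + _]] mt /eqP pt => /(_ _ mt).
  by rewrite pt.
(* If [|h t|] were at most [3 * e / 4], every [k] with [y k] through [t] would be bad, as
   [|g (x k) t|] is at least [e]; there are at most [M] bad ones. *)
have hbig t : (m <= size t)%N -> (M < count (fun k => passes t (y k)) K)%N ->
    3 * e / 4 < `|h t|.
  move=> mt Mt; apply: contrapT => hs; move: Mt; apply/negP; rewrite -leqNgt.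
  apply: leq_trans (badM t); apply: sub_in_count => k kK pt; rewrite /bad leNgt.
  apply/negP => kt; apply: hs; have := gK t k kK mt pt.
  have : `|g (x k) t| <= `|g (x k) t - h t| + `|h t|.
    by rewrite -[in leLHS](subrK (h t) (g (x k) t)) ler_normD.
  by lra.
have /choice[n0 n0P] : forall k, exists n0, k \in K -> forall n, (n0 <= n)%N ->
    `|h (mkseq (y k) n)| < e / 4.
  move=> k; have [kK|] := boolP (k \in K); last by exists 0%N.
  have [_ _ [_ _ ya]] := xyP _ (KK0 _ kK).
  by have [n0 n0P] := partial_sum_cvg0 ya Us' (size s').+1 e40; exists n0 => _ n /n0P.
have y2K k n : k \in K -> (y k n < 2)%N by move=> /KK0; exact: y2.
have Kcount : count (fun k => passes u (y k)) K = size K.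
  by apply/eqP; rewrite -all_count; apply/allP.
have [|| v [uv vM v2M]] := binary_split (M := M) (u := u) y2K.
- by rewrite Kcount; lia.
(* A node far out met by more than [M] of the [y k] has [h] large by [hbig], yet it lies on one of
   them, along which [h] tends to zero. *)
- exists (maxn m (\max_(k <- K) n0 k)) => t; rewrite geq_max => /andP[mt nt].
  rewrite leqNgt; apply/negP => Mt; have := hbig t mt Mt.
  have /hasP[k kK /eqP pt] : has (fun k => passes t (y k)) K.
    by rewrite has_count; exact: leq_ltn_trans Mt.
  have n0t : (n0 k <= size t)%N.
    by apply: leq_trans nt; exact: (@leq_bigmax_seq _ _ xpredT).
  by have := n0P k kK (size t) n0t; rewrite pt; lra.
have sNv : (N <= size v)%N by rewrite -su size_prefix.
have mN : (m <= N)%N by rewrite leq_maxl.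
have hv := hbig v (leq_trans mN sNv) vM.
(* Of more than [3 * M] indices, at most [2 * M] have [y k] through [v] and at most [M] are bad at
   [v]. *)
have [k [kK nvk nbk]] : exists k, [/\ k \in K, ~~ passes v (y k) & ~~ bad v k].
  apply: contrapT => nk; have := badM v; apply/negP; rewrite -ltnNge.
  have : (count (predC (fun k => passes v (y k))) K <= count (bad v) K)%N.
    apply: sub_in_count => k kK nvk; apply: contrapT => nb; apply: nk; exists k.
    by split=> //; apply/negP.
  move=> h1; suff : (3 * M < 2 * M + count (bad v) K)%N by lia.
  apply: leq_trans KM _; rewrite -(count_predC (fun k => passes v (y k)) K).
  exact: leq_add.
(* [g (x k)] is large at [v] because [h] is large there and [k] is not bad, and at [w] because [w]
   lies on the sequence [y k] itself. *)
pose w := mkseq (y k) (size v).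
have vw : v <> w by move=> vw; move/negP: nvk; apply; rewrite vw passes_mkseq.
have svw : size v = size w by rewrite size_mkseq.
have uw : prefix u w.
  apply: prefix_passes (Ku k kK) (passes_mkseq _ _) _.
  by rewrite size_mkseq su.
have Lu : {in L, forall t, (size t <= size u)%N}.
  move=> t tL; rewrite su; apply: leq_trans (leq_maxr _ _).
  exact: (@leq_bigmax_seq _ _ xpredT).
have [L' [aL' LL' L'P]] := antichain_extend aL Lu uv uw svw vw.
have [bxk pxk _] := xyP _ (KK0 _ kK).
have gv : e / 2 <= `|g (x k) v|.
  have : `|h v| <= `|g (x k) v - h v| + `|g (x k) v|.
    by rewrite distrC -[in leLHS](subrK (g (x k) v) (h v)) ler_normD.
  by move: nbk; rewrite /bad -ltNge; lra.
have gw : e / 2 <= `|g (x k) w|.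
  have := gK w k kK; rewrite -svw => /(_ (leq_trans mN sNv) (passes_mkseq _ _)).
  by lra.
have [l1 l1P] := g_continuous v bxk e40; have [l2 l2P] := g_continuous w bxk e40.
(* Long enough to stay inside the cylinder of [s'] and to keep [g] within [e / 4] of its values at
   both [v] and [w]. *)
pose l := maxn (size (rcons s' k)) (maxn l1 l2).
exists (mkseq (x k) l), L'; split=> //.
- by have [] := bxk.
- apply: prefix_trans ss' _; apply: prefix_trans (prefix_rcons _ k) _.
  by apply: prefix_passes pxk (passes_mkseq _ _) _; rewrite size_mkseq leq_maxl.
move=> z bz pz t /L'P[tL|].
  apply: Lg tL => //; apply: passes_prefix pz; apply: prefix_trans ss' _.
  apply: prefix_trans (prefix_rcons _ k) _.
  by apply: prefix_passes pxk (passes_mkseq _ _) _; rewrite size_mkseq leq_maxl.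
have near l0 t0 : (l0 <= l)%N -> e / 2 <= `|g (x k) t0| -> (forall x', body_g x' ->
    passes (mkseq (x k) l0) x' -> `|g (x k) t0 - g x' t0| < e / 4) ->
    e / 4 <= `|g z t0|.
  move=> l0l gt /(_ z bz (passes_prefix (prefix_mkseq _ l0l) pz)).
  have : `|g (x k) t0| <= `|g (x k) t0 - g z t0| + `|g z t0|.
    by rewrite -[in leLHS](subrK (g z t0) (g (x k) t0)) ler_normD.
  by lra.
by case=> ->; [apply: near gv l1P|apply: near gw l2P];
  rewrite !leq_max leqnn ?orbT.
Qed.

(** The branches outside [D] are sorted by the constant [m] of [far_from] and by the bound [j] on
    antichains where [g] is large; the countable [D] is split into single points. The category
    argument makes one class dense in a cylinder, and iterating [larger_antichain] there beats the
    bound [j]. *)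
Lemma no_fast_branching : False.
Proof.
have /countable_injP[code codeI] := D_countable.
pose H (i : nat * nat + nat) : set (nat -> nat) := match i with
  | inl mj => [set x | [/\ ~ D x, exists y, far_from mj.1 x y & forall L, antichain L ->
      {in L, forall t, mj.1.+1%:R^-1 / 4 <= `|g x t|} -> (size L <= mj.2)%N]]
  | inr n => [set x | D x /\ code x = n] end.
have Usucc s : U s -> exists k, U (rcons s k).
  move=> Us; have [s' [L [ss' _]]] := U_branching 1 Us; case: L => // k L _ LU.
  have Usk := LU k (mem_head _ _).
  move/prefixP: ss' => [[|i w] es]; first by exists k; rewrite -[s]cats0 -es.
  exists i; apply: U_tree.2 Usk; rewrite es -cat_rcons rcons_cat prefix_prefix//.
have cov x : tree_body U x -> exists i, H i x.
  move=> bx; have [Dx|Dx] := pselect (D x); first by exists (inr (code x)).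
  have [y [y2 [m hm] ya]] := g_far bx Dx.
  have e40 : 0 < m.+1%:R^-1 / 4 :> R by rewrite divr_gt0// invr_gt0.
  have [j hj] := g_antichain bx Dx e40.
  by exists (inl (m, j)); split=> //; exists y.
have [[[m j]|n] [s0 [Us0 dense]]] := dense_on_cylinder U_tree Usucc cov; last first.
  (* A single point of [D] is not dense in a cylinder, as two branches split off inside it. *)
  have [s' [L [ss']]] := U_branching 2 Us0; case: L => [|i1 [|i2 L]]// + _ LU.
  rewrite /= inE negb_or => /andP[/andP[/eqP i12 _] _]; apply: i12.
  have ext i : prefix s0 (rcons s' i) by apply: prefix_trans ss' _; exact: prefix_rcons.
  have [x1 [_ p1 [D1 c1]]] := dense _ (LU i1 (mem_head _ _)) (ext _).
  have i2L : i2 \in [:: i1, i2 & L] by rewrite !inE eqxx orbT.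
  have [x2 [_ p2 [D2 c2]]] := dense _ (LU i2 i2L) (ext _).
  have x12 : x1 = x2 by apply: codeI; rewrite ?inE// c1 c2.
  by rewrite -(passes_rcons p1) -(passes_rcons p2) x12.
have step r : exists s L, [/\ U s, prefix s0 s, antichain L, (r <= size L)%N &
    forall x, body_g x -> passes s x -> {in L, forall t, m.+1%:R^-1 / 4 <= `|g x t|}].
  elim: r => [|r [s [L [Us s0s aL rL Lg]]]].
    by exists s0, [::]; split=> //; rewrite prefix_refl.
  have [||||s' [L' [Us' ss' aL' LL' L'g]]] := @larger_antichain m s L => //.
    move=> s' Us' ss'; have [x [bx px [Dx yx _]]] := dense s' Us' (prefix_trans s0s ss').
    by exists x.
  exists s', L'; split=> //; first exact: prefix_trans s0s ss'.
  exact: leq_ltn_trans rL LL'.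
have [s [L [Us s0s aL jL Lg]]] := step j.+1.
have [x [bx px [Dx _ hj]]] := dense s Us s0s.
by have := hj L aL (Lg x (conj bx Dx) px); rewrite leqNgt jL.
Qed.

End branching.

(** * The compactification of a Psi-space *)

Section psi_space.
Context (R : realType) (N : countType) (AA : set (set N)).
Implicit Types (g : KA AA -> R^o) (A : AA) (n : N).

Definition point_at n : KA AA := Some (psi_point n).
Definition set_at A : KA AA := Some (psi_set A).

(** Continuity on the compactification at scale [d] in finitary form: up to [d] and off the points
    [sN], [g] is constant on each member of [sA] and equals its value at infinity elsewhere. *)
Definition adapted g (d : R) (sA : seq AA) (sN : seq N) : Prop :=
  [/\ forall A, A \notin sA -> `|g (set_at A) - g None| < d,
      forall A n, A \in sA -> val A n -> n \notin sN ->
        `|g (point_at n) - g (set_at A)| < d &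
      forall n, n \notin sN -> (forall A, A \in sA -> ~ val A n) ->
        `|g (point_at n) - g None| < d].

Lemma cvg_at_set g A : {for set_at A, continuous g} -> forall d : R, 0 < d ->
  exists sN : seq N, forall n, val A n -> n \notin sN ->
    `|g (point_at n) - g (set_at A)| < d.
Proof.
move=> /cvgrPdist_lt gA d /gA [F /= finF FP].
have /finite_seqP[s sE] := finF; exists s => n An ns.
rewrite distrC; apply: (FP (psi_point n)); right; exists n => //; split => //.
by rewrite sE /= => ns'; rewrite ns' in ns.
Qed.

(** Shaped so that a finite cover can be read off: a point in the neighbourhood of a set belongs to
    that set, and only the one of [None] covers without restriction. *)
Definition basic_open (z : KA AA) : set (KA AA) :=
  match z with
  | None => setT
  | Some (psi_point n) => [set point_at n]
  | Some (psi_set A) => Some @` psi_base A set0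
  end.

Lemma basic_open_mem z : basic_open z z.
Proof. by case: z => [[n|A]|] //=; exists (psi_set A) => //; left. Qed.

Lemma open_psi_base A F : finite_set F -> open (psi_base A F).
Proof.
move=> finF; rewrite openE => z [->|[n [An Fn] <-]]; first by exists F.
by apply/principal_filterP; right; exists n.
Qed.

Lemma open_psi_point n : open [set (psi_point n : psi AA)].
Proof. by rewrite openE => _ ->; apply/principal_filterP. Qed.

Lemma basic_open_open z : open (basic_open z).
Proof.
case: z => [[n|A]|] /=; last exact: openT.
- rewrite (_ : [set _] = Some @` [set (psi_point n : psi AA)]).
    by apply: one_point_compactification_open_some; exact: open_psi_point.
  by rewrite image_set1.
- by apply: one_point_compactification_open_some; exact/open_psi_base/finite_set0.
Qed.

(** By compactness finitely many neighbourhoods on which [g] varies by less than [d] cover the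
    space. Their centres give [sA] and [sN], and whatever neither accounts for is covered from
    [None]. *)
Lemma continuous_adapted g (d : R) (s0 : seq AA) : continuous g -> 0 < d ->
  exists (sA : seq AA) (sN : seq N), {subset s0 <= sA} /\ adapted g d sA sN.
Proof.
move=> cg d0.
have /choice[E EP] : forall A, exists sN : seq N, forall n, val A n -> n \notin sN ->
    `|g (point_at n) - g (set_at A)| < d.
  by move=> A; apply: cvg_at_set d0; exact: cg.
pose f z := [set w | `|g w - g z| < d] `&` basic_open z.
have := @one_point_compactification_compact (psi AA).
rewrite compact_cover => /(_ _ setT f)[z _|z _|K _ KP].
- apply: openI; last exact: basic_open_open.
  rewrite (_ : [set _ | _] = g @^-1` ball (g z) d); last first.
    by apply/seteqP; split=> w /=; rewrite -ball_normE /= distrC.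
  by apply: open_comp; [move=> w _; exact: cg|exact: ball_open].
- by exists z => //; split; [rewrite /= subrr normr0|exact: basic_open_mem].
pose sets := pmap (fun z : KA AA => if z is Some (psi_set A) then Some A else None) (finmap.enum_fset K).
pose points := pmap (fun z : KA AA => if z is Some (psi_point n) then Some n else None) (finmap.enum_fset K).
have inA A : set_at A \in finmap.enum_fset K -> A \in sets.
  by move=> AK; rewrite mem_pmap; apply/mapP; exists (set_at A).
have inN n : point_at n \in finmap.enum_fset K -> n \in points.
  by move=> AK; rewrite mem_pmap; apply/mapP; exists (point_at n).
(* Besides the centres, [sN] takes in the finitely many points of each listed set where [g] is not
   yet close to its value at that set. *)
exists (s0 ++ sets), (points ++ flatten [seq E A | A <- s0 ++ sets]).
split; first by move=> A As; rewrite mem_cat As.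
split.
- move=> A; rewrite mem_cat negb_or => /andP[_ As].
  have [[[n|A']|] /= zK [gz]] := KP (set_at A) I.
  + by case.
  + by case=> z [->|[n _ <-]] // [AA']; move: As; rewrite -AA' inA.
  + by [].
- move=> A n As An; rewrite mem_cat negb_or => /andP[_ /flatten_mapP nE].
  by apply: EP => //; apply/negP => nEA; apply: nE; exists A.
- move=> n; rewrite mem_cat negb_or => /andP[np _] nA.
  have [[[n'|A']|] /= zK [gz]] := KP (point_at n) I.
  + by case=> nn; move: np; rewrite nn inN.
  + case=> z [->//|[n1 [An1 _] <-]] [nn]; case: (nA A').
      by rewrite mem_cat inA ?orbT.
    by rewrite -nn.
  + by [].
Qed.

Hypothesis AD : almost_disjoint AA.

(** A filter on this set that does not cluster at [psi_set A] contains a finite set of points of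
    [A], and clusters there. *)
Lemma compact_psi_base A : compact (psi_base A set0).
Proof.
move=> F PF FA; apply: contrapT => nc.
have [V [P [FP VA VP]]] : exists V P, [/\ F P, nbhs (psi_set A) V & V `&` P = set0].
  apply: contrapT => h; apply: nc; exists (psi_set A); split; first by left.
  move=> P V FP VA; apply: contrapT => PV; apply: h; exists V, P; split=> //.
  by rewrite setIC; apply: contrapT => /eqP/set0P.
case: VA => F0 /= finF0 F0V.
pose X := psi_point @` (val A `&` F0) : set (psi AA).
have XA : X `<=` psi_base A set0.
  by move=> _ [n [An _] <-]; right; exists n => //; split.
have cX : compact X.
  by apply: finite_compact; apply: finite_image; apply: finite_setIr.
have FX : F X.
  apply: filterS (filterI FP FA) => z [Pz [zA|[n [An _] nz]]].
    have : (V `&` P) z by split => //; apply: F0V; left.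
    by rewrite VP.
  rewrite -nz; exists n => //; split=> //; apply: contrapT => nF0.
  have : (V `&` P) z by split => //; apply: F0V; right; exists n.
  by rewrite VP.
by have [z [Xz cz]] := cX F PF FX; apply: nc; exists z; split=> //; exact: XA.
Qed.

(** Almost disjointness: another set [A'] has a neighbourhood that omits the finite intersection
    with [A]. *)
Lemma closed_psi_base A : closed (psi_base A set0).
Proof.
rewrite -openC openE => -[n|A'] nA.
  by apply/principal_filterP.
exists (val A `&` val A').
  apply: AD.2; [exact: set_valP|exact: set_valP|].
  by move=> AA'; apply: nA; left; congr psi_set; apply/esym/val_inj.
move=> z [->|[n [A'n nAA'] <-]] //; case=> // -[n' [An' _] [nn]].
by apply: nAA'; split => //; rewrite -nn.
Qed.

(** At a set, the points of [sN] and the finite intersections with the other members of [sA] are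
    removed. At infinity, the neighbourhood is the complement of the compact closed set formed by
    [sN] and the members of [sA]. *)
Lemma adapted_continuous g :
  (forall d : R, 0 < d -> exists (sA : seq AA) (sN : seq N), adapted g d sA sN) -> continuous g.
Proof.
move=> H z; apply/(@cvgrPdist_lt _ R^o _ (nbhs z) (nbhs_filter z) g) => d d0; case: z => [[n|A]|].
- by apply/principal_filterP; rewrite /= subrr normr0.
(* A set outside [sA] is compared with its points through the value at infinity, hence the half. *)
- have d20 : 0 < d / 2 by rewrite divr_gt0.
  have [sA [sN [h1 h2 h3]]] := H _ d20.
  exists ([set` sN] `|` \bigcup_(A' in [set` seq.filter (predC1 A) sA]) (val A `&` val A')).
    rewrite /= finite_setU; split; first exact: finite_seq.
    apply: bigcup_finite; first exact: finite_seq.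
    move=> A' /=; rewrite mem_filter => /andP[/= A'A _].
    apply: AD.2; [exact: set_valP|exact: set_valP|].
    by move=> AA'; move/eqP: A'A; apply; apply/esym/val_inj.
  move=> z [->|[n [An /not_orP[nN nA]] <-]] /=; first by rewrite subrr normr0.
  have nsN : n \notin sN by apply/negP.
  have [As|As] := boolP (A \in sA).
    by rewrite distrC; apply: lt_le_trans (h2 A n As An nsN) _; lra.
  rewrite -(subrK (g None) (g _)) -addrA (splitr d).
  apply: le_lt_trans (ler_normD _ _) _; apply: ltrD; first exact: h1.
  rewrite distrC; apply: h3 => // A' A's A'n; apply: nA; exists A' => //=.
  by rewrite mem_filter /= A's andbT; apply/eqP => AA'; rewrite -AA' A's in As.
- have [sA [sN [h1 h2 h3]]] := H _ d0.
  pose W := \bigcup_(A in [set` sA]) psi_base A set0 `|` psi_point @` [set` sN].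
  exists W.
    split.
      apply: compactU; last by apply: finite_compact; exact/finite_image/finite_seq.
      rewrite bigcup_seq.
      by apply: bigsetU_compact => A _; exact: compact_psi_base.
    apply: closedU.
      by apply: closed_bigcup; [exact: finite_seq|move=> A _; exact: closed_psi_base].
    rewrite -openC openE => -[n|A] nP; first exact/principal_filterP.
    exists [set` sN]; first exact: finite_seq.
    by move=> z [->|[n [_ nN] <-]] [n' n'N]// [nn]; apply: nN; rewrite -nn.
  move=> z [[z' nW <-]|->] /=; last by rewrite subrr normr0.
  rewrite distrC; case: z' nW => [n|A] nW; last first.
    by apply: h1; apply/negP => As; apply: nW; left; exists A => //; left.
  apply: h3; first by apply/negP => ns; apply: nW; right; exists n.
  move=> A As An; apply: nW; left; exists A => //; right; exists n => //.
by split.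
Qed.

End psi_space.

Arguments point_at {N AA}.
Arguments set_at {N AA}.

(** * Norms in JL spaces *)

Section norm.
Context (R : realType) (N : countType) (AA : set (set N)).
Implicit Types (f g : KA AA -> R^o).

Lemma lp_sum_le r f (M : R) :
  (forall s : seq AA, uniq s -> \sum_(A <- s) `|f (set_at A)| `^ r <= M) ->
  (lp_sum r f <= M%:E)%E.
Proof.
move=> fM; apply: ub_ereal_sup => _ [F [finF _] <-].
have /finite_seqP[s ->] := finF.
rewrite (_ : [set` s] = [set` undup s]); last first.
  by apply/seteqP; split=> A /=; rewrite mem_undup.
by rewrite -fsbig_seq ?undup_uniq// sumEFin lee_fin; apply/fM/undup_uniq.
Qed.

Lemma le_lp_sum r f (s : seq AA) : uniq s ->
  ((\sum_(A <- s) `|f (set_at A)| `^ r)%:E <= lp_sum r f)%E.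
Proof.
move=> us; apply: ereal_sup_ubound; exists [set` s].
  by split=> //; exact: finite_seq.
by rewrite -fsbig_seq// sumEFin.
Qed.

Lemma lp_sum_lty r f : 0 < r -> (lp_seminorm r f < +oo)%E ->
  exists C : R, forall s : seq AA, uniq s -> \sum_(A <- s) `|f (set_at A)| `^ r <= C.
Proof.
move=> r0 fy; exists (fine (lp_seminorm r f) `^ r) => s us.
rewrite -lee_fin; apply: le_trans (le_lp_sum r f us) _.
by rewrite -lp_seminorm_le// ?fine_ge0 ?lp_seminorm_ge0// -lp_seminorm_fin.
Qed.

Lemma lp_sum_seminorm_lty r f (M : R) : 0 < r -> 0 <= M -> (lp_sum r f <= M%:E)%E ->
  (lp_seminorm r f <= (M `^ r^-1)%:E)%E.
Proof.
move=> r0 M0 fM; rewrite lp_seminorm_le ?powR_ge0//.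
by rewrite -powRrM mulVf ?gt_eqF// powRr1.
Qed.

Lemma supnorm_le_JL_norm (p : \bar R) f : supnorm f <= JL_norm p f.
Proof. by case: p => [r||]//=; rewrite le_max lexx. Qed.

(** Bounds the norm of a function of modulus at most one that is nonzero on at most [k] sets of the
    family; the [1] accounts for the supremum norm. *)
Definition growth (p : \bar R) (k : nat) : R :=
  if p is r%:E then Num.max 1 (k%:R `^ r^-1) else 1.

Lemma lp_sum_card r f (L : seq AA) : 0 < r -> (forall z, `|f z| <= 1) ->
  (forall A : AA, A \notin L -> f (set_at A) = 0) -> (lp_sum r f <= (size L)%:R%:E)%E.
Proof.
move=> r0 f1 fL; apply: lp_sum_le => s us.
apply: (@le_trans _ _ (\sum_(A <- s) (A \in L)%:R)).
  apply: ler_sum => A _; have [AL|/fL ->] := boolP (A \in L); last first.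
    by rewrite normr0 powR0 ?gt_eqF.
  rewrite (_ : true%:R = 1 `^ r :> R); last by rewrite powR1.
  apply: (ge0_ler_powR (ltW r0)); rewrite ?nnegrE//.
rewrite -natr_sum ler_nat (_ : \sum_(A <- s) _ = count (mem L) s)%N; last first.
  by elim: (s) => [|A s' IH]; rewrite ?big_nil// big_cons IH.
by rewrite -size_filter; apply: uniq_leq_size; [exact: filter_uniq|move=> A; rewrite mem_filter => /andP[]].
Qed.

Lemma JL_norm_le_growth (p : \bar R) f (L : seq AA) : (1 < p)%E ->
  (forall z, `|f z| <= 1) -> (forall A : AA, A \notin L -> f (set_at A) = 0) ->
  JL_norm p f <= growth p (size L).
Proof.
move=> p1 f1 fL; have := supnorm_le f1; case: p p1 => //= r.
rewrite lte_fin => r1 sf; have r0 : 0 < r by lra.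
have h := lp_sum_seminorm_lty r0 (ler0n _ _) (lp_sum_card r0 f1 fL).
rewrite ge_max; apply/andP; split; first by rewrite le_max sf.
rewrite le_max; apply/orP; right.
by rewrite -lee_fin -lp_seminorm_fin// (le_lt_trans h) ?ltry.
Qed.

(** For finite [p = r], [k] is the product of [k^(1/r)] and [k^(1 - 1/r)], and the second exponent
    is positive because [1 < r]. *)
Lemma growth_sublinear (p : \bar R) (c eta : R) : (1 < p)%E -> 0 < eta ->
  exists k, c * growth p k < k%:R * eta.
Proof.
move=> p1 eta0; have [c0|c0] := lerP c 0.
  exists 1%N; rewrite mul1r; apply: le_lt_trans eta0.
  by rewrite mulr_le0_ge0//; rewrite /growth; case: (p) => [r||] //=.
have big (q : R) : exists k : nat, q < k%:R.
  by exists (Num.truncn q).+1; exact: truncnS_gt.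
case: p p1 => [r| |]//=; last first.
  by move=> _; have [k hk] := big (c / eta); exists k; rewrite mulr1 -ltr_pdivrMr.
rewrite lte_fin => r1; have r0 : 0 < r by lra.
have e0 : 0 < 1 - r^-1 by rewrite subr_gt0 invf_lt1.
pose q := c / eta; have q0 : 0 < q by rewrite divr_gt0.
(* The first bound serves the constant [1] in [growth], the second the power of [k]. *)
have [k hk] := big (Num.max q (q `^ (1 - r^-1)^-1)).
move: hk; rewrite gt_max => /andP[hk1 hk2].
have k0 : 0 < k%:R :> R by exact: lt_trans hk1.
exists k; rewrite maxr_pMr ?(ltW c0)// gt_max mulr1 -ltr_pdivrMr// hk1 /=.
have h : q < k%:R `^ (1 - r^-1).
  have := gt0_ltr_powR e0 _ _ hk2; rewrite !nnegrE powR_ge0 ltW// => /(_ isT isT).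
  by rewrite -powRrM mulVf ?gt_eqF// powRr1 ?ltW.
have -> : k%:R * eta = k%:R `^ (1 - r^-1) * eta * k%:R `^ r^-1.
  by rewrite mulrAC -powRD ?subrK ?powRr1 ?ltW// gt_eqF ?implybT// k0.
by rewrite ltr_pM2r ?powR_gt0// -ltr_pdivrMr.
Qed.

End norm.

Section JL_elements.
Context (R : realType) (p : \bar R) (p1 : (1 < p)%E) (N : countType) (AA : set (set N)).
Implicit Types f g : JL p1 AA.

Lemma JL_continuous f : continuous f.
Proof. by have := JL_funP f; rewrite inE => -[]. Qed.

Lemma JL_le_norm f z : `|f z| <= `|f|.
Proof.
rewrite JL_normE; apply: le_trans (supnorm_le_JL_norm _ _).
exact: supnorm_ub (@JL_continuous f).
Qed.

Lemma JL_addE f g z : (f + g) z = f z + g z. Proof. by []. Qed.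
Lemma JL_subE f g z : (f - g) z = f z - g z. Proof. by []. Qed.
Lemma JL_scaleE (c : R) f z : (c *: f) z = c * f z. Proof. by []. Qed.
Lemma JL_sumE I (s : seq I) (F : I -> JL p1 AA) z :
  (\sum_(i <- s) F i) z = \sum_(i <- s) F i z.
Proof. by elim/big_rec2 : _ => // i u v _ <-. Qed.

Lemma in_JL (f0 : KA AA -> R^o) (L : seq AA) : almost_disjoint AA ->
  (forall d : R, 0 < d -> exists (sA : seq AA) (sN : seq N), adapted f0 d sA sN) ->
  (forall z, `|f0 z| <= 1) -> (forall A : AA, A \notin L -> f0 (set_at A) = 0) ->
  f0 \in @JL_pred R N AA p.
Proof.
move=> AD ad f1 fL; rewrite inE; split; first exact: adapted_continuous.
case: (p) p1 => //= r; rewrite lte_fin => r1; have r0 : 0 < r by lra.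
have h := lp_sum_seminorm_lty r0 (ler0n _ _) (lp_sum_card r0 f1 fL).
by rewrite (le_lt_trans h) ?ltry.
Qed.

End JL_elements.

(** * The functionals induced by an operator *)

Section indicators.
Context (R : realType) (p : \bar R) (p1 : (1 < p)%E) (U : set (seq nat)).
Local Notation K := (KA (branches U)).

(** Zero when [s] is not in [U], so that nodes can be indexed by all finite sequences. *)
Definition node_fun (s : seq nat) (z : K) : R^o :=
  if z is Some (psi_point n) then (val n == s)%:R else 0.

Definition branch_fun (x : nat -> nat) (z : K) : R^o :=
  match z with
  | Some (psi_point n) => (passes (val n) x)%:R
  | Some (psi_set A) => (`[< val A = branch U x >])%:R
  | None => 0
  end.

Lemma node_fun_JL s : node_fun s \in @JL_pred R _ (branches U) p.
Proof.
apply: (@in_JL _ _ p1 _ _ _ [::]) => //; first exact: branches_almost_disjoint.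
- move=> d d0; exists [::].
  exists (if pselect (U s) is left Us then [:: exist _ s (mem_set Us)] else [::]).
  split=> [A _||n ns _] //=; first by rewrite subr0 normr0.
  rewrite subr0; case: eqP => [ns'|_]; last by rewrite normr0.
  case: pselect ns => [Us|[]]; last by rewrite -ns'; exact: set_valP.
  by rewrite inE => /eqP; case; apply: val_inj.
- by move=> [[n|A]|] /=; rewrite ?normr0// ger0_norm// lern1 leq_b1.
Qed.

Lemma passes_branch (A : set U) x n : A = branch U x -> (A n : Prop) <-> passes (val n) x.
Proof.
move=> ->; split=> [[k ->]|/eqP h]; first exact: passes_mkseq.
by exists (size (val n)).
Qed.

Definition branch_set x (bx : tree_body U x) : branches U :=
  exist _ (branch U x) (mem_set (ex_intro2 _ _ x bx erefl)).

Lemma branch_fun_out x (bx : tree_body U x) (A : branches U) :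
  A \notin [:: branch_set bx] -> branch_fun x (set_at A) = 0.
Proof.
rewrite inE => BA /=; case: asboolP => // Ax; move/eqP: BA; case.
exact: val_inj.
Qed.

Lemma branch_fun_JL x : tree_body U x -> branch_fun x \in @JL_pred R _ (branches U) p.
Proof.
move=> bx; have out := @branch_fun_out _ bx.
apply: (@in_JL _ _ p1 _ _ _ [:: branch_set bx]) => //.
- exact: branches_almost_disjoint.
- move=> d d0; exists [:: branch_set bx], [::]; split.
  + by move=> B /out ->; rewrite subr0 normr0.
  + move=> B n; rewrite inE => /eqP -> An _ /=.
    by rewrite asboolT// ((passes_branch n erefl).1 An) subrr normr0.
  + move=> n _ /(_ (branch_set bx) (mem_head _ _)) nn /=; rewrite subr0.
    case: (boolP (passes _ _)) => [/(passes_branch n erefl).2//|_].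
    by rewrite normr0.
- by move=> [[n|B]|] /=; rewrite ?normr0// ger0_norm// lern1 leq_b1.
Qed.

Definition node_ind s : JL p1 (branches U) := MkJL p1 (node_fun_JL s).
Definition branch_ind x : JL p1 (branches U) := insubd 0 (branch_fun x).

Lemma branch_indE x z : tree_body U x -> branch_ind x z = branch_fun x z.
Proof. by move=> /branch_fun_JL h; rewrite /branch_ind (insubdK _ h). Qed.

Lemma branch_inj x y : tree_body U x -> branch U x = branch U y -> x = y.
Proof.
move=> bx xy; apply/funext => n.
have : branch U x (exist _ (mkseq x n.+1) (mem_set (bx n.+1))) by exists n.+1.
rewrite xy => -[k /= e].
have nk : n.+1 = k by move/(congr1 size): e; rewrite !size_mkseq.
rewrite -nk in e; by move/(congr1 (nth 0%N ^~ n)): e; rewrite !nth_mkseq.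
Qed.

(** The indicator of the branch with its first [l] nodes removed. Finitely many distinct branches
    have disjoint tails once [l] is large. *)
Definition branch_tail l x : JL p1 (branches U) :=
  branch_ind x - \sum_(0 <= n < l) node_ind (mkseq x n).

Lemma branch_tail_set l x A : tree_body U x ->
  branch_tail l x (set_at A) = (`[< val A = branch U x >])%:R.
Proof.
move=> bx; rewrite JL_subE branch_indE// JL_sumE big1 ?subr0//.
Qed.

Lemma branch_tail_None l x : tree_body U x -> branch_tail l x None = 0.
Proof. by move=> bx; rewrite JL_subE branch_indE// JL_sumE big1 ?subr0. Qed.

Lemma branch_tail_point l x n : tree_body U x ->
  branch_tail l x (point_at n) = ((l <= size (val n))%N && passes (val n) x)%:R.
Proof.
move=> bx; rewrite JL_subE branch_indE// JL_sumE /=.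
have [ln|nl] := leqP l (size (val n)).
  rewrite big_nat big1 ?subr0// => i /andP[_ il] /=.
  case: eqP => // /(congr1 size); rewrite size_mkseq => e.
  by have := leq_trans il ln; rewrite [X in (_ < X)%N]e ltnn.
rewrite (bigD1_seq (size (val n))) ?mem_index_iota ?iota_uniq//= big1 ?addr0.
  by rewrite /passes eq_sym subrr.
move=> i /eqP ni; case: eqP => // /(congr1 size); rewrite size_mkseq => ei.
by case: ni.
Qed.

End indicators.

Lemma sum_le1 (R : realType) (I : eqType) (P : pred I) (s : seq I) : uniq s ->
  {in s &, forall i j, P i -> P j -> i = j} -> \sum_(i <- s) (P i)%:R <= 1 :> R.
Proof.
move=> us Ps; rewrite -natr_sum (_ : \sum_(i <- s) _ = count P s)%N.
  by rewrite lern1 count_le1.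
by elim: (s) => [|i r IH]; rewrite ?big_nil// big_cons IH.
Qed.

Lemma size_le_cover (I J : eqType) (s : seq I) (r : seq J) (Q : J -> pred I) :
  {in s, forall i, exists2 j, j \in r & Q j i} ->
  (forall j, (count (Q j) s <= 1)%N) -> (size s <= size r)%N.
Proof.
elim: r s => [|j r IH] s sr Q1.
  by case: s sr {Q1} => // i s /(_ i (mem_head _ _))[].
rewrite -(count_predC (Q j) s) /= -add1n leq_add// -size_filter; apply: IH.
  move=> i; rewrite mem_filter => /andP[/= nQ /sr[k]].
  by rewrite inE => /orP[/eqP ->|kr Qk]; [rewrite (negbTE nQ)|exists k].
move=> k; apply: leq_trans (Q1 k); apply: leq_count_subseq; exact: filter_subseq.
Qed.

Section operator.
Context (R : realType) (p : \bar R) (p1 : (1 < p)%E) (U V : set (seq nat)).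
Local Notation X := (JL p1 (branches U)).
Local Notation Y := (JL p1 (branches V)).
Context (T : {linear X -> Y}) (C : R).
Hypotheses (C0 : 0 <= C) (TC : forall f, `|T f| <= C * `|f|).

(** A sequence outside [V] is sent to infinity, so that [tau] vanishes at it. *)
Definition node_at (t : seq nat) : KA (branches V) :=
  if insub t is Some n then point_at n else None.

Definition tau (t : seq nat) (f : X) : R := T f (node_at t) - T f None.

Lemma tauD t f g : tau t (f + g) = tau t f + tau t g.
Proof. by rewrite /tau linearD !JL_addE opprD addrACA. Qed.

Lemma tauZ t (c : R) f : tau t (c *: f) = c * tau t f.
Proof. by rewrite /tau linearZ !JL_scaleE mulrBr. Qed.

Lemma tau0 t : tau t 0 = 0.
Proof. by rewrite -(scale0r (0 : X)) tauZ mul0r. Qed.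

Lemma tau_sum t I (s : seq I) (F : I -> X) :
  tau t (\sum_(i <- s) F i) = \sum_(i <- s) tau t (F i).
Proof. by elim/big_rec2 : _ => [|i u v _ <-]; [exact: tau0|rewrite tauD]. Qed.

Lemma tau_le t f : `|tau t f| <= 2 * C * `|f|.
Proof.
apply: le_trans (ler_normB _ _) _.
have := JL_le_norm (T f) (node_at t); have := JL_le_norm (T f) None; have := TC f.
by lra.
Qed.

(** The left side is the value of [tau t] at a combination of the [F i] with signs; that combination
    has modulus at most one and vanishes on the sets outside [L]. *)
Lemma tau_signed_sum t (I : eqType) (s : seq I) (F : I -> X) (L : seq (branches U)) :
  (forall z, \sum_(i <- s) `|F i z| <= 1) ->
  (forall A : branches U, A \notin L -> {in s, forall i, F i (set_at A) = 0}) ->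
  \sum_(i <- s) `|tau t (F i)| <= 2 * C * growth p (size L).
Proof.
move=> F1 FL; pose f := \sum_(i <- s) Num.sg (tau t (F i)) *: F i.
have fz z : f z = \sum_(i <- s) Num.sg (tau t (F i)) * F i z by rewrite /f JL_sumE.
have -> : \sum_(i <- s) `|tau t (F i)| = tau t f.
  by rewrite tau_sum; apply: eq_bigr => i _; rewrite tauZ normrEsg.
have fL : `|f| <= growth p (size L).
  rewrite JL_normE; apply: JL_norm_le_growth => // [z|A /FL AL].
    rewrite fz; apply: le_trans (ler_norm_sum _ _ _) _; apply: le_trans (F1 z).
    apply: ler_sum => i _; rewrite normrM ler_piMl// normr_sg.
    by case: eqP.
  by rewrite fz big_seq big1// => i /AL ->; rewrite mulr0.
apply: le_trans (ler_norm _) _; apply: le_trans (tau_le _ _) _.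
by rewrite ler_wpM2l// mulr_ge0.
Qed.

(** Node indicators are disjoint and vanish on the whole family, so the previous bound applies with
    [L] empty: the coefficients are absolutely summable. *)
Lemma tau_node_bounded t S : uniq S ->
  \sum_(s <- S) `|tau t (node_ind p1 U s)| <= 2 * C * growth p 0.
Proof.
move=> uS; apply: (tau_signed_sum t (L := [::])) => // -[[n|A]|] /=.
- under eq_bigr do rewrite normr_nat.
  by apply: sum_le1 => // s s' _ _ /eqP <- /eqP <-.
- by rewrite big1// => s _; rewrite normr0.
- by rewrite big1// => s _; rewrite normr0.
Qed.

(** The image is far from its value at infinity only on finitely many branches and at finitely many
    further nodes, and a branch meets an antichain at most once. *)
Lemma tau_antichain x delta : 0 < delta -> exists j, forall L, antichain L ->
  {in L, forall t, delta <= `|tau t (branch_ind p1 U x)|} -> (size L <= j)%N.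
Proof.
move=> d0; set f := T (branch_ind p1 U x).
have [sA [sN [_ [_ hA hN]]]] := continuous_adapted [::] (JL_continuous (f := f)) d0.
exists (size ([seq inl A | A <- sA] ++ [seq inr n | n <- sN])) => L [uL aL] Ld.
pose Q (j : branches V + V) (t : seq nat) := match j with
  | inl A => `[< exists2 n : V, val n = t & val A n >] | inr n => val n == t end.
apply: (@size_le_cover _ _ _ _ Q) => [t tL|[A|n]].
- have := Ld t tL; rewrite /tau -/f /node_at.
  case: insubP => [n _ nt|]; last by rewrite subrr normr0 leNgt d0.
  have [ns|ns] := boolP (n \in sN) => fd.
    by exists (inr n); rewrite /= ?nt// mem_cat [X in _ || X]map_f ?orbT.
  have [nA|nA] := pselect (forall A, A \in sA -> ~ val A n).
    by move: fd; rewrite leNgt hN.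
  have [A As An] : exists2 A, A \in sA & val A n.
    apply: contrapT => h; apply: nA => A As An; apply: h; by exists A.
  exists (inl A); first by rewrite mem_cat map_f.
  by apply/asboolP; exists n.
- apply: count_le1 => // t t' tL t'L /asboolP[n nt An] /asboolP[n' nt' An'].
  rewrite -nt -nt' in tL t'L *.
  have [y _ yA] := set_valP A.
  move: An An'; rewrite -yA => -[k nk] [k' nk'].
  have [h|/ltnW h] := leqP k k'; [|apply/esym].
    by have := prefix_mkseq y h; rewrite -nk -nk'; exact: (aL _ _ tL t'L).
  by have := prefix_mkseq y h; rewrite -nk -nk'; exact: (aL _ _ t'L tL).
- by apply: count_le1 => // t t' _ _ /eqP <- /eqP <-.
Qed.

Lemma tau_branch_tail t l x : tau t (branch_tail p1 U l x) =
  tau t (branch_ind p1 U x) - \sum_(0 <= n < l) tau t (node_ind p1 U (mkseq x n)).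
Proof. by rewrite /branch_tail tauD -scaleN1r tauZ mulN1r tau_sum. Qed.

Definition divergent t (eta : R) := [set x | tree_body U x /\
  forall l0, exists l, (l0 <= l)%N /\ eta <= `|tau t (branch_tail p1 U l x)|].

(** The tails of [k] divergent branches, cut at a level where they are disjoint, would have total
    effect at least [k * (eta / 2)], against the bound [2 * C * growth p k], which is sublinear in
    [k]. *)
Lemma finite_divergent t eta : 0 < eta -> finite_set (divergent t eta).
Proof.
move=> eta0; apply: contrapT => /infiniteP/pcard_leP[f].
have fI i j : f i = f j -> i = j by move=> fij; apply: ('inj_f) => //; rewrite inE.
have fD i : divergent t eta (f i) by exact: funS.
have eta20 : 0 < eta / 2 by rewrite divr_gt0.
have [k Ck] := growth_sublinear (2 * C) p1 eta20.
have [S0 S0P] := summable_tail (P := fun=> True)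
  (fun S uS _ => tau_node_bounded t uS) eta20.
pose l0 := (\max_(s <- S0) size s).+1.
(* Two tails of one branch cut beyond [l0] differ by nodes outside [S0], so a lower bound [eta] at
   some later level gives [eta / 2] at every level from [l0] on. *)
have tail l x : tree_body U x -> divergent t eta x -> (l0 <= l)%N ->
    eta / 2 <= `|tau t (branch_tail p1 U l x)|.
  move=> bx [_ /(_ l)[l' [ll' hl']]] l0l.
  have : `|tau t (branch_tail p1 U l x) - tau t (branch_tail p1 U l' x)| < eta / 2.
    rewrite !tau_branch_tail (big_cat_nat (leq0n l) ll') /=.
    have e (a b c : R) : (a - b) - (a - (b + c)) = c by lra.
    rewrite e.
    apply: le_lt_trans (ler_norm_sum _ _ _) _.
    rewrite -(big_map (mkseq x) xpredT (fun s => `|tau t (node_ind p1 U s)|)).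
    apply: S0P => //.
      rewrite map_inj_uniq ?iota_uniq// => i j /(congr1 size).
      by rewrite !size_mkseq.
    move=> s /mapP[n]; rewrite mem_index_iota => /andP[ln _] ->.
    apply/negP => nS; have := leq_trans l0l ln.
    rewrite /l0 ltnNge -[X in (X <= _)%N](size_mkseq x n) => /negP; apply.
    exact: (@leq_bigmax_seq _ _ xpredT).
  set u := tau _ _ in hl' *; set v := tau _ _.
  by have := ler_normB v (v - u); rewrite subKr; lra.
have bf i : tree_body U (f i) by case: (fD i).
have /choice[d dP] : forall ij : nat * nat, exists n,
    ij.1 <> ij.2 -> f ij.1 n <> f ij.2 n.
  move=> [i j] /=; apply: contrapT => /forallNP h; apply: (h 0%N) => ij; exfalso.
  apply: ij; apply: fI; apply/funext => n; apply: contrapT => fn.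
  by apply: (h n).
(* Beyond a level at which each two of the first [k] branches differ. *)
pose l := maxn l0 (\max_(i < k) \max_(j < k) (d (i : nat, j : nat)).+1).
have sep i j : (i < k)%N -> (j < k)%N -> mkseq (f i) l = mkseq (f j) l -> i = j.
  move=> ik jk e; apply: contrapT => /(dP (i, j)); apply.
  have dl : (d (i, j) < l)%N.
    rewrite leq_max; apply/orP; right.
    apply: leq_trans (leq_bigmax (Ordinal ik)).
    exact: (leq_bigmax (F := fun j : 'I_k => (d (i, j : nat)).+1) (Ordinal jk)).
  by move/(congr1 (nth 0%N ^~ (d (i, j)))): e; rewrite !nth_mkseq.
pose L := [seq branch_set (bf i) | i <- iota 0 k].
have F1 z : \sum_(i <- iota 0 k) `|branch_tail p1 U l (f i) z| <= 1.
  case: z => [[n|A]|].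
  - under eq_bigr do rewrite branch_tail_point// normr_nat.
    apply: sum_le1 (iota_uniq 0 k) _ => i j.
    rewrite !mem_iota => ik jk /andP[ln /eqP pi] /andP[_ /eqP pj]; apply: sep => //.
    by rewrite -(take_mkseq _ ln) -[RHS](take_mkseq _ ln) pi pj.
  - under eq_bigr do rewrite branch_tail_set// normr_nat.
    apply: sum_le1 (iota_uniq 0 k) _ => i j _ _ /asboolP -> /asboolP ij.
    by apply: fI; apply: branch_inj ij.
  - by rewrite big1// => i _; rewrite branch_tail_None// normr0.
have : \sum_(i <- iota 0 k) `|tau t (branch_tail p1 U l (f i))| <= 2 * C * growth p k.
  have := tau_signed_sum t (L := [seq branch_set (bf i) | i <- iota 0 k]) F1.
  rewrite size_map size_iota; apply=> A AL i ik.
  rewrite branch_tail_set//; case: asboolP => // Ai; move/negP: AL; case.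
  by apply/mapP; exists i => //; exact: val_inj.
apply/negP; rewrite -ltNge; apply: lt_le_trans Ck _.
have -> : k%:R * (eta / 2) = \sum_(i <- iota 0 k) (eta / 2).
  by rewrite big_const_seq count_predT size_iota iter_addr_0 mulr_natl.
by apply: ler_sum => i _; apply: tail => //; exact: leq_maxl.
Qed.

Lemma countable_divergent :
  countable [set x | exists t n, divergent t n.+1%:R^-1 x].
Proof.
rewrite (_ : [set x | _] =
  \bigcup_(tn in [set: seq nat * nat]) divergent tn.1 tn.2.+1%:R^-1); last first.
  apply/seteqP; split=> [x [t [n xtn]]|x [[t n] _ xtn]]; first by exists (t, n).
  by exists t, n.
apply: bigcup_countable => // -[t n] _; apply: finite_set_countable.
by apply: finite_divergent; rewrite invr_gt0.
Qed.

Lemma not_divergent_cvg x t eta : tree_body U x -> 0 < eta ->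
  (forall n, ~ divergent t n.+1%:R^-1 x) ->
  exists l0, forall l, (l0 <= l)%N -> `|tau t (branch_ind p1 U x) -
    \sum_(0 <= n < l) tau t (node_ind p1 U (mkseq x n))| < eta.
Proof.
move=> bx eta0 xd; pose n := Num.truncn eta^-1.
have ne : n.+1%:R^-1 < eta.
  by rewrite invf_plt ?posrE//; exact: truncnS_gt.
apply: contrapT => /forallNP h; apply: (xd n); split=> // l0.
have /existsNP[l /not_implyP[l0l /negP]] := h l0; rewrite -leNgt -tau_branch_tail => hl.
by exists l; split=> //; exact: le_trans (ltW ne) hl.
Qed.

Lemma node_at_mkseq (y : nat -> nat) (by_ : tree_body V y) n :
  node_at (mkseq y n) = point_at (exist _ (mkseq y n) (mem_set (by_ n))).
Proof.
rewrite /node_at; case: insubP => [m _ mE|]; last by rewrite mem_set.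
by congr point_at; exact: val_inj.
Qed.

Lemma cvg_along_branch (f : Y) (A : branches V) y (eta : R) : tree_body V y ->
  val A = branch V y -> 0 < eta -> exists n0, forall n, (n0 <= n)%N ->
    `|f (node_at (mkseq y n)) - f (set_at A)| < eta.
Proof.
move=> yV Ay eta0.
have [sN sNP] := cvg_at_set (JL_continuous (f := f) (x := set_at A)) eta0.
exists (\max_(m <- sN) size (val m)).+1 => n nN; rewrite node_at_mkseq.
apply: sNP; first by rewrite Ay; exists n.
apply/negP => ns; move: nN; rewrite ltnNge => /negP; apply.
rewrite -[X in (X <= _)%N](size_mkseq y n).
exact: (@leq_bigmax_seq _ _ xpredT (fun m : V => size (val m)) _ ns).
Qed.

End operator.

(** * Separability *)

Definition round (R : realType) (q : nat) (v : R) : int := Num.floor (v * q.+1%:R).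

Lemma round_close (R : realType) q (u v : R) :
  round q u = round q v -> `|u - v| <= q.+1%:R^-1.
Proof.
move=> uv; have /andP[u1 u2] := floor_itv (u * q.+1%:R).
have /andP[v1 v2] := floor_itv (v * q.+1%:R).
rewrite -/(round q u) -/(round q v) uv intrD in u1 u2 v1 v2.
rewrite -[leRHS]mul1r ler_pdivlMr// -[X in _ * X]gtr0_norm// -normrM mulrBl.
by rewrite ler_norml; lra.
Qed.

Section separability.
Context (R : realType) (p : \bar R) (p1 : (1 < p)%E) (N : countType) (AA : set (set N)).
Implicit Types f g : KA AA -> R^o.

Definition small_off f (eta : R) (sA : seq AA) : Prop :=
  if p is r%:E then forall s : seq AA, uniq s -> {in s, forall A, A \notin sA} ->
    \sum_(A <- s) `|f (set_at A)| `^ r < eta else True.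

Lemma small_off_exists f (eta : R) : JL_set p f -> 0 < eta ->
  exists sA, small_off f eta sA.
Proof.
rewrite /small_off; case: (p) p1 => [r||]; [|by exists [::]..].
rewrite lte_fin => r1 [_ fy] eta0; have r0 : 0 < r by lra.
have [C fC] := lp_sum_lty r0 fy.
have [sA sAP] := summable_tail (P := fun=> True) (fun s us _ => fC s us) eta0.
by exists sA => s us sAs; exact: sAP.
Qed.

Lemma small_off_sub f (eta : R) (sA sB : seq AA) : {subset sA <= sB} ->
  small_off f eta sA -> small_off f eta sB.
Proof.
rewrite /small_off; case: p => // r sAB fs s us sBs; apply: fs => // A /sBs.
by apply: contra; exact: sAB.
Qed.

Hypothesis AA_infinite : forall s : seq AA, exists A, A \notin s.

(** If the value at infinity were nonzero, sets outside any finite list would carry at least half of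
    it, against summability. *)
Lemma JL_None f : JL_set p f -> if p is r%:E then f None = 0 else True.
Proof.
move=> Jf; have := small_off_exists Jf; rewrite /small_off.
case: (p) p1 => // r; rewrite lte_fin => r1 fs; have r0 : 0 < r by lra.
apply/eqP; rewrite -normr_le0 leNgt; apply/negP => f0.
have f20 : 0 < `|f None| / 2 by rewrite divr_gt0.
have [s1 s1P] := fs _ (powR_gt0 r f20).
have [sA [sN [_ [fA _ _]]]] := continuous_adapted [::] Jf.1 f20.
have [A] := AA_infinite (s1 ++ sA); rewrite mem_cat negb_or => /andP[A1 AsA].
have := s1P [:: A] isT; rewrite big_seq1 ltNge => /(_ _)/negP; apply.
  by move=> B; rewrite inE => /eqP ->.
apply: (ge0_ler_powR (ltW r0)); rewrite ?nnegrE ?divr_ge0//.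
have := fA A AsA; have := ler_normB (f (set_at A)) (f (set_at A) - f None).
by rewrite subKr; lra.
Qed.

(** Separability is shown for functions whose values on the family differ from the value at infinity
    only on the countable set [D]. *)
Variables (D : set AA) (D_countable : countable D).

Definition vanishing_off f := forall A, ~ D A -> f (set_at A) = f None.

(** Finite data that, with values rounded to mesh [1 / (q + 1)], determine [f] up to a small error.
    Keeping [sA] inside [D] leaves countably many choices, and the last clause controls the rounding
    error in the sum of powers. *)
Definition sketch f (eta : R) (sA : seq AA) (sN : seq N) (q : nat) : Prop :=
  [/\ uniq sA, {in sA, forall A, D A}, adapted f eta sA sN, small_off f eta sA &
    q.+1%:R^-1 <= eta /\
    if p is r%:E then (size sA)%:R * (q.+1%:R^-1 `^ r) <= eta else True].

Lemma precision_exists (r eta : R) (k : nat) : 0 < r -> 0 < eta ->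
  exists q, q.+1%:R^-1 <= eta /\ k%:R * (q.+1%:R^-1 `^ r) <= eta.
Proof.
move=> r0 eta0; pose d := Num.min eta ((eta / k.+1%:R) `^ r^-1).
have d0 : 0 < d by rewrite lt_min eta0 powR_gt0// divr_gt0.
exists (Num.truncn d^-1).
have qd : (Num.truncn d^-1).+1%:R^-1 <= d.
  by rewrite invf_ple ?posrE// ltW// truncnS_gt.
split; first by apply: le_trans qd _; rewrite ge_min lexx.
apply: (@le_trans _ _ (k%:R * (eta / k.+1%:R))).
  rewrite ler_wpM2l//.
  have h : (Num.truncn d^-1).+1%:R^-1 <= (eta / k.+1%:R) `^ r^-1.
    by apply: le_trans qd _; rewrite ge_min lexx orbT.
  apply: le_trans (ge0_ler_powR (ltW r0) _ _ h) _; rewrite ?nnegrE ?powR_ge0//.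
  by rewrite -powRrM mulVf ?gt_eqF// powRr1// divr_ge0// ltW.
by rewrite mulrA ler_pdivrMr// mulrC ler_wpM2l ?ler_nat// ltW.
Qed.

Lemma sketch_exists f (eta : R) : JL_set p f -> vanishing_off f -> 0 < eta ->
  exists sA sN q, sketch f eta sA sN q.
Proof.
move=> Jf fD eta0; have [s1 s1P] := small_off_exists Jf eta0.
have [sA [sN [s1A [fA fAN fN]]]] := continuous_adapted s1 Jf.1 eta0.
pose sD := [seq A <- undup sA | `[< D A >]].
have sDP A : A \notin sD -> A \notin sA \/ ~ D A.
  rewrite mem_filter mem_undup negb_and => /orP[/asboolP|]; by [right|left].
have sDA A : A \in sD -> A \in sA by rewrite mem_filter mem_undup => /andP[].
have [q [q1 q2]] : exists q, q.+1%:R^-1 <= eta /\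
    if p is r%:E then (size sD)%:R * (q.+1%:R^-1 `^ r) <= eta else True.
  case: (p) p1 => [r||] //; rewrite ?lte_fin => r1.
    by apply: precision_exists => //; lra.
  by have [q [q1 _]] := precision_exists 0 (ltr01 : 0 < 1 :> R) eta0; exists q.
exists sD, sN, q; split=> //.
- by rewrite filter_uniq// undup_uniq.
- by move=> A; rewrite mem_filter => /andP[/asboolP].
- split.
  + by move=> A /sDP[|/fD ->]; [exact: fA|rewrite subrr normr0].
  + by move=> A n /sDA; exact: fAN.
  + move=> n nN nD; have [nA|/existsNP[A /not_implyP[As /contrapT An]]] :=
      pselect (forall A, A \in sA -> ~ val A n); first exact: fN.
    have DA : ~ D A.
      move=> DA; apply: (nD A) => //; rewrite mem_filter mem_undup As andbT.
      exact/asboolP.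
    by rewrite -(fD A DA); exact: fAN.
- have := JL_None Jf; have := small_off_sub s1A s1P; rewrite /small_off.
  case: (p) p1 => // r; rewrite lte_fin => r1 fs f0 s us sDs.
  have r0 : 0 < r by lra.
  rewrite (bigID (mem sA)) /= big_seq_cond big1 ?add0r; last first.
    move=> A /andP[/sDs/sDP[/negbTE ->//|/fD ->] _].
    by rewrite f0 normr0 powR0// gt_eqF.
  rewrite -big_filter; apply: fs; first exact: filter_uniq.
  by move=> A; rewrite mem_filter => /andP[].
Qed.

Lemma powR_normB_le (r u v : R) : 1 <= r ->
  `|u - v| `^ r <= 2 `^ r * (`|u| `^ r + `|v| `^ r).
Proof.
move=> r1; have r0 : 0 < r by lra.
apply: (@le_trans _ _ ((`|u| + `|v|) `^ r)).
  by apply: (ge0_ler_powR (ltW r0)); rewrite ?nnegrE ?addr_ge0// ler_normB.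
apply: le_trans (lp_convex r1 ltr01 ltr01 (normr_ge0 u) (normr_ge0 v)) _.
rewrite powR1 divr1 -mulrDr -mulrA ler_wpM2l ?powR_ge0//.
by rewrite ler_piMl ?addr_ge0 ?powR_ge0// ler_pdivrMr ?ltr0n// mul1r lerDl.
Qed.

(** In the supremum norm, two approximations and one rounding cost at most [3 * eta]. For finite
    [p], the sum of powers is split into its part on [sA], governed by the mesh, and the small
    remainders of [f] and [g]. *)
Lemma sketch_close (d : R) : 0 < d -> exists2 eta, 0 < eta & forall f g sA sN q,
  sketch f eta sA sN q -> sketch g eta sA sN q ->
  `|f None - g None| <= q.+1%:R^-1 ->
  {in sA, forall A, `|f (set_at A) - g (set_at A)| <= q.+1%:R^-1} ->
  {in sN, forall n, `|f (point_at n) - g (point_at n)| <= q.+1%:R^-1} ->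
  JL_norm p (f - g) <= d.
Proof.
move=> d0; have d30 : 0 < d / 3 by rewrite divr_gt0.
have sup_close f g sA sN q eta : eta <= d / 3 -> sketch f eta sA sN q ->
    sketch g eta sA sN q -> `|f None - g None| <= q.+1%:R^-1 ->
    {in sA, forall A, `|f (set_at A) - g (set_at A)| <= q.+1%:R^-1} ->
    {in sN, forall n, `|f (point_at n) - g (point_at n)| <= q.+1%:R^-1} ->
    supnorm (f - g) <= d.
  move=> ed [_ _ [fA fAN fN] _ [qe _]] [_ _ [gA gAN gN] _ _] h0 hA hN.
  have qd : q.+1%:R^-1 <= d.
    by apply: le_trans qe _; apply: le_trans ed _; lra.
  have tri (a b u v : R) : `|a - u| < eta -> `|b - v| < eta ->
      `|u - v| <= q.+1%:R^-1 -> `|a - b| <= d.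
    by move: qe ed; rewrite !ltr_norml !ler_norml; set e := _^-1; lra.
  apply: supnorm_le => -[[n|A]|]; rewrite -?/(point_at n) -?/(set_at A).
  - have [ns|ns] := boolP (n \in sN).
      exact: le_trans (hN _ ns) qd.
    have [nA|/existsNP[A /not_implyP[As /contrapT An]]] :=
      pselect (forall A, A \in sA -> ~ val A n).
      exact: tri (fN n ns nA) (gN n ns nA) h0.
    exact: tri (fAN A n As An ns) (gAN A n As An ns) (hA A As).
  - have [As|As] := boolP (A \in sA).
      exact: le_trans (hA _ As) qd.
    exact: tri (fA A As) (gA A As) h0.
  - exact: le_trans h0 qd.
have [[r pr]|np] := pselect (exists r, p = r%:E); last first.
  exists (d / 3) => // f g sA sN q hf hg h0 hA hN.
  have := sup_close f g sA sN q _ (lexx _) hf hg h0 hA hN.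
  by case: p np => [r np|//|//]; exfalso; apply: np; exists r.
have r1 : 1 < r by move: p1; rewrite pr lte_fin.
have r0 : 0 < r by lra.
(* The part on [sA] contributes [eta], the part off it at most [2^r * (eta + eta)]. *)
pose c := 1 + 2 `^ r * 2 : R.
have c0 : 0 < c by rewrite ltr_wpDr// mulr_ge0// powR_ge0.
exists (Num.min (d / 3) (d `^ r / c)).
  by rewrite lt_min d30 divr_gt0// powR_gt0.
set eta := Num.min _ _ => f g sA sN q hf hg h0 hA hN.
have eta1 : eta <= d / 3 by rewrite /eta ge_min lexx.
have eta2 : eta * c <= d `^ r by rewrite -ler_pdivlMr// /eta ge_min lexx orbT.
have hs := sup_close _ _ _ _ _ _ eta1 hf hg h0 hA hN.
have hl : (lp_seminorm r (f - g)%R <= d%:E)%E.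
  rewrite lp_seminorm_le ?(ltW d0)//; apply: lp_sum_le => s us.
  apply: le_trans eta2; rewrite (bigID (mem sA)) /=.
  move: hf hg => [usA _ _ + [_ +]] [_ _ _ + _]; rewrite /small_off pr => fs qs gs.
  rewrite /c mulrDr mulr1 lerD//.
    apply: le_trans qs; rewrite -big_filter.
    apply: (@le_trans _ _ (\sum_(A <- [seq A <- s | A \in sA]) q.+1%:R^-1 `^ r)).
      rewrite big_seq [leRHS]big_seq; apply: ler_sum => A.
      rewrite mem_filter => /andP[As _]; apply: (ge0_ler_powR (ltW r0)).
      - by rewrite nnegrE.
      - by rewrite nnegrE.
      - exact: hA.
    rewrite big_const_seq count_predT iter_addr_0 -[leLHS]mulr_natl.
    rewrite ler_wpM2r ?powR_ge0// ler_nat; apply: uniq_leq_size.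
      exact: filter_uniq.
    by move=> A; rewrite mem_filter => /andP[].
  rewrite -big_filter.
  set s' := [seq A <- s | A \notin sA].
  have us' : uniq s' by exact: filter_uniq.
  have s'A : {in s', forall A, A \notin sA}.
    by move=> A; rewrite mem_filter => /andP[].
  apply: (@le_trans _ _ (\sum_(A <- s') 2 `^ r *
      (`|f (set_at A)| `^ r + `|g (set_at A)| `^ r))).
    by apply: ler_sum => A _; apply: powR_normB_le; exact: ltW.
  rewrite -mulr_sumr big_split /= [leRHS]mulrCA ler_wpM2l ?powR_ge0//.
  by have := fs s' us' s'A; have := gs s' us' s'A; lra.
rewrite pr /= ge_max hs /= -lee_fin -lp_seminorm_fin//.
by rewrite (le_lt_trans hl) ?ltry.
Qed.

(* Separability of the space of functions constant off [D]. *)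
Lemma code_exists (d : R) : 0 < d -> exists code : (KA AA -> R^o) -> nat,
  forall f g, JL_set p f -> JL_set p g -> vanishing_off f -> vanishing_off g ->
  code f = code g -> JL_norm p (f - g) <= d.
Proof.
move=> d0; have [eta eta0 close] := sketch_close d0.
have /countable_injP[cD cDI] := D_countable.
have /choice[sk skP] : forall f, exists s : seq AA * seq N * nat,
    JL_set p f -> vanishing_off f -> sketch f eta s.1.1 s.1.2 s.2.
  move=> f; have [Jf|] := pselect (JL_set p f); last by exists ([::], [::], 0%N).
  have [fD|] := pselect (vanishing_off f); last by exists ([::], [::], 0%N).
  by have [sA [sN [q h]]] := sketch_exists Jf fD eta0; exists (sA, sN, q).
(* Members of [sA] are coded through the injection of [D] into the naturals, since the family may be
   uncountable. *)
pose code f := let: (sA, sN, q) := sk f in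
  (map cD sA, sN, q, [seq round q (f (set_at A)) | A <- sA],
   [seq round q (f (point_at n)) | n <- sN], round q (f None)).
exists (fun f => pickle (code f)) => f g Jf Jg fD gD.
move=> /(pcan_inj pickleK); rewrite /code.
have := skP f Jf fD; have := skP g Jg gD.
case: (sk f) => -[sA sN] q; case: (sk g) => -[sA' sN'] q' /= hg hf [sAA sNN qq].
have E : sA = sA'.
  move: hf hg => [_ + _ _ _] [_ + _ _ _]; elim: sA sA' sAA {close} => [|A s IH] [|A' s']//=.
  move=> [AA' ss'] sD s'D; congr (_ :: _).
    by apply: cDI; rewrite ?inE //; [apply: sD|apply: s'D]; rewrite mem_head.
  by apply: IH => // B Bs; [apply: sD|apply: s'D]; rewrite inE Bs orbT.
subst sA' sN' q' => vA vN v0; apply: close hf hg _ _ _.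
- exact: round_close.
- by move=> A As; apply: round_close; exact: (eq_in_map _ _ _).2 vA A As.
- by move=> n ns; apply: round_close; exact: (eq_in_map _ _ _).2 vN n ns.
Qed.

End separability.

(** * The theorem *)

Lemma card_successors (U : set (seq nat)) (s : seq nat) n :
  (immediate_successors U s #= `I_n)%card ->
  exists L, [/\ uniq L, size L = n & {in L, forall k, U (rcons s k)}].
Proof.
move=> /card_set_bijP[f [_ _ fS]].
have /choice[h hP] : forall i, exists t, (i < n)%N -> immediate_successors U s t /\ f t = i.
  move=> i; have [ni|] := boolP (i < n)%N; last by exists [::].
  by have [t st ft] := fS i ni; exists t.
have hs i : i \in iota 0 n -> [/\ h i = rcons s (last 0%N (h i)), U (h i) & f (h i) = i].
  rewrite mem_iota add0n => ni; have [[Ui [k hk]] fh] := hP i ni.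
  by split=> //; rewrite hk last_rcons.
exists [seq last 0%N (h i) | i <- iota 0 n]; split; last 2 first.
- by rewrite size_map size_iota.
- by move=> _ /mapP[i /hs[hi Ui _] ->]; rewrite -hi.
rewrite map_inj_in_uniq ?iota_uniq// => i j /hs[hi _ fi] /hs[hj _ fj] ij.
by rewrite -fi -fj hi hj ij.
Qed.

(** Every node extends to level at least [k], where more than [k] successors are available. *)
Lemma increasing_branching (U : set (seq nat)) : is_tree U ->
  (forall s, U s -> (immediate_successors U s #= `I_(size s).+1)%card) ->
  forall s k, U s -> exists s' L,
    [/\ prefix s s', uniq L, (k <= size L)%N & {in L, forall i, U (rcons s' i)}].
Proof.
move=> [U0 Upre] Usucc s k Us.
have [s' [ss' Us' ks']] : exists s', [/\ prefix s s', U s' & (k <= size s')%N].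
  elim: k => [|k [s' [ss' Us' ks']]]; first by exists s; rewrite prefix_refl.
  have [L [_ + LU]] := card_successors (Usucc s' Us'); case: L LU => // i L Li _.
  exists (rcons s' i); rewrite size_rcons; split=> //.
    by apply: prefix_trans ss' _; exact: prefix_rcons.
  by apply: Li; exact: mem_head.
have [L [uL sL UL]] := card_successors (Usucc s' Us').
by exists s', L; split=> //; rewrite sL leqW.
Qed.

Lemma dyadic_body (y : nat -> nat) :
  tree_body dyadic_tree y <-> forall n, (y n < 2)%N.
Proof.
split=> [yd n|y2 n]; last by apply/allP => _ /mapP[i _ ->].
have /allP := yd n.+1; apply; apply/mapP; exists n => //.
by rewrite mem_iota add0n ltnSn.
Qed.

Lemma dyadic_infinite (s : seq (branches dyadic_tree)) : exists A, A \notin s.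
Proof.
pose y (k n : nat) : nat := (n == k).
have yd k : tree_body dyadic_tree (y k).
  by apply/dyadic_body => n; rewrite /y; case: eqP.
apply: contrapT => /forallNP sA.
have : (size [seq branch_set (yd k) | k <- iota 0 (size s).+1] <= size s)%N.
  apply: uniq_leq_size => [|A _]; last by apply: contrapT => /negP/sA.
  rewrite map_inj_uniq ?iota_uniq// => i j /(congr1 val)/branch_inj -/(_ (yd i)) /(congr1 (@^~ i)).
  by rewrite /y eqxx; case: eqP.
by rewrite size_map size_iota ltnn.
Qed.

(** For each [n], only the finitely many sets of an adapted list can deviate by [1 / (n + 1)] or
    more. *)
Lemma countable_not_constant (R : realType) (N : countType) (AA : set (set N))
  (f : KA AA -> R^o) : continuous f -> countable [set A : AA | f (set_at A) <> f None].
Proof.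
move=> cf; pose F n := [set A : AA | n.+1%:R^-1 <= `|f (set_at A) - f None|].
apply: (@sub_countable _ _ _ (\bigcup_(n in [set: nat]) F n)).
  apply: subset_card_le => A /= /eqP; rewrite -subr_eq0 -normr_gt0 => fA.
  exists (Num.truncn `|f (set_at A) - f None|^-1) => //=.
  by rewrite /F /= invf_ple ?posrE// ltW// truncnS_gt.
apply: bigcup_countable => // n _; apply: finite_set_countable.
have n0 : 0 < n.+1%:R^-1 :> R by rewrite invr_gt0.
have [sA [sN [_ [h _ _]]]] := continuous_adapted [::] cf n0.
apply: sub_finite_set (finite_seq sA) => A; rewrite /F /= leNgt.
by apply: contraNT => /h.
Qed.

(** * Branches whose image is constant off a countable family *)

Section embedding.
Context (R : realType) (p : \bar R) (p1 : (1 < p)%E) (U V : set (seq nat)).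
Local Notation X := (JL p1 (branches U)).
Local Notation Y := (JL p1 (branches V)).
Context (T : {linear X -> Y}) (d : R).
Hypotheses (d0 : 0 < d) (Td : forall f, 1 <= `|f| -> d <= `|T f|).
Hypothesis V_infinite : forall s : seq (branches V), exists A, A \notin s.

(** Along a branch outside this family, the coefficient of every node indicator tends to zero. *)
Definition moved_sets : set (branches V) :=
  [set A | exists s, T (node_ind p1 U s) (set_at A) <> T (node_ind p1 U s) None].

Lemma countable_moved_sets : countable moved_sets.
Proof.
rewrite (_ : moved_sets = \bigcup_(s in [set: seq nat])
  [set A | T (node_ind p1 U s) (set_at A) <> T (node_ind p1 U s) None]); last first.
  by apply/seteqP; split=> [A [s sA]|A [s _ sA]]; exists s.
apply: bigcup_countable => // s _; exact/countable_not_constant/JL_continuous.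
Qed.

Lemma norm_branch_indB x y : tree_body U x -> tree_body U y -> x <> y ->
  1 <= `|branch_ind p1 U x - branch_ind p1 U y|.
Proof.
move=> bx by_ xy; apply: le_trans (JL_le_norm _ (set_at (branch_set bx))).
rewrite JL_subE !branch_indE//= asboolT// asboolF ?subr0 ?normr1//.
by move=> /(branch_inj bx).
Qed.

(** Distinct branch indicators are at distance at least one, so their images are at distance at
    least [d]; codes of precision [d / 2] then separate them. *)
Lemma countable_vanishing : countable [set x | tree_body U x /\
  vanishing_off moved_sets (T (branch_ind p1 U x))].
Proof.
have d20 : 0 < d / 2 by rewrite divr_gt0.
have [code codeP] := code_exists p1 V_infinite countable_moved_sets d20.
apply/countable_injP; exists (fun x => code (T (branch_ind p1 U x))) => x y.
rewrite !inE => -[bx vx] [by_ vy] cxy; apply: contrapT => xy.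
have := Td (norm_branch_indB bx by_ xy); rewrite linearB JL_normE.
have JT (f : Y) : JL_set p f by exact: set_mem (JL_funP f).
have := codeP _ _ (JT _) (JT _) vx vy cxy.
by move=> h1 h2; have := le_trans h2 h1; lra.
Qed.

End embedding.

(** [d] comes from continuity of the inverse at zero: an image of norm below [d] has a preimage of
    norm below one. *)
Lemma isomorphic_bounds (R : realType) (X Y : normedModType R) :
  isomorphic_to_subspace X Y -> exists (T : {linear X -> Y}) (C d : R),
    [/\ 0 <= C, forall f, `|T f| <= C * `|f|, 0 < d &
      forall f, 1 <= `|f| -> d <= `|T f|].
Proof.
move=> [T [S [cT TS cS]]].
have /linear_boundedP[C0 [_ hC]] := continuous_linear_bounded 0 (cT 0).
have S0 : S 0 = 0 by rewrite -(linear0 T) TS.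
have r0 : range T 0 by exists 0 => //; exact: linear0.
have cS0 : S @ within (range T) (nbhs 0) --> S 0.
  exact: (subspace_continuousP _ _).1 cS 0 r0.
move: cS0 => /cvgrPdist_lt/(_ 1 ltr01); rewrite S0 => /nbhs_ballP[d d0 hd].
exists T, (Num.max 0 C0 + 1), d; split=> //.
- by rewrite addr_ge0// le_max lexx.
- move=> f; apply: hC; rewrite ltr_pwDr// le_max lexx orbT//.
- move=> f f1; rewrite leNgt; apply/negP => fd.
  have := hd (T f); rewrite -ball_normE /= sub0r normrN => /(_ fd) h.
  have := h (ex_intro2 _ _ f I erefl); rewrite TS sub0r normrN.
  by rewrite ltNge f1.
Qed.

Theorem corollary5p4 (R : realType) (Upsilon : set (seq nat))
  (Upsilon_tree : is_tree Upsilon)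
  (Upsilon_succ : forall s : seq nat, Upsilon s ->
     (immediate_successors Upsilon s #= `I_(size s).+1)%card)
  (p : \bar R) (p1 : (1 < p)%E) :
  ~ isomorphic_to_subspace (JL p1 (branches Upsilon)) (JL p1 (branches dyadic_tree)).
Proof.
move=> /isomorphic_bounds[T [C [d [C0 TC d0 Td]]]].
(* The exceptional branches: those where some [tau t] is not the sum of its node coefficients, and
   those with no unmoved dyadic branch on which the image leaves its value at infinity. *)
pose W := [set x | exists t n, divergent T t n.+1%:R^-1 x] `|`
  [set x | tree_body Upsilon x /\ vanishing_off (moved_sets T) (T (branch_ind p1 Upsilon x))].
apply: (@no_fast_branching R Upsilon (fun t s => tau T t (node_ind p1 Upsilon s))
  (2 * C * growth p 0) (fun x t => tau T t (branch_ind p1 Upsilon x)) W) => //.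
- exact: increasing_branching.
- by move=> t S uS _; exact: tau_node_bounded.
- rewrite /W -bigcup2E; apply: bigcup_countable => // -[|[|n]] _ /=.
  + exact: (countable_divergent C0 TC).
  + exact: (countable_vanishing d0 Td dyadic_infinite).
  + exact: countable0.
- move=> x bx Wx t eta eta0; apply: not_divergent_cvg => // n xtn.
  by apply: Wx; left; exists t, n.
- move=> x bx Wx.
  have /existsNP[A /not_implyP[nA fA]] :
      ~ vanishing_off (moved_sets T) (T (branch_ind p1 Upsilon x)).
    by move=> v; apply: Wx; right.
  have [y yd yA] := set_valP A; exists y; split; first exact/dyadic_body.
    move/eqP: fA; rewrite -subr_eq0 -normr_gt0; set e := `|_| => e0.
    have e20 : 0 < e / 2 by rewrite divr_gt0.
    have [n0 hn0] := cvg_along_branch (T (branch_ind p1 Upsilon x)) yd (esym yA) e20.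
    (* Large enough that [tau] stays above [e / 2] from this level on and that [1 / (m + 1)] is at
       most [e / 2]. *)
    exists (maxn n0 (Num.truncn (e / 2)^-1)) => n; rewrite geq_max => /andP[n0n en].
    apply: (@le_trans _ _ (e / 2)).
      rewrite invf_ple ?posrE//; apply: ltW; apply: lt_le_trans (truncnS_gt _) _.
      by rewrite ler_nat ltnS leq_maxr.
    have := hn0 n n0n; rewrite /tau /e distrC.
    set u := T _ (node_at _ _); set v := T _ None; set w := T _ (set_at A).
    by have := ler_distD u w v; lra.
  move=> s _ eta eta0.
  have [n0 hn0] := cvg_along_branch (T (node_ind p1 Upsilon s)) yd (esym yA) eta0.
  exists n0 => n /hn0; rewrite /tau.
  (* [A] is unmoved, so the limit of the coefficients along its branch is zero. *)
  have <- // : T (node_ind p1 Upsilon s) (set_at A) = T (node_ind p1 Upsilon s) None.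
  by apply: contrapT => sA; apply: nA; exists s.
- by move=> x bx _ delta delta0; exact: tau_antichain.
Qed.
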